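(* Let $n\ge 1$ and $d\in\mathbb{N}$. There exists a constant $C(n,d)>0$, depending only on $n$ and $d$, with the property that $$( * )\qquad h_{\min}-h_{((r+1)n)}\le \frac{C(n,d)}{r^2}\,(h_{\max}-h_{\min})\quad\text{for every } h\in\mathbb{R}[\mathbf{x}] \text{ of degree } d \text{ and every integer } r\ge 1 \text{ with } r\ge\pi d\sqrt{2n}.$$ For any constant $C(n,d)>0$ satisfying $( * )$, any polynomial $f\in\mathbb{R}[\mathbf{x}]$ of degree $d$ that is nonnegative on $\mathrm{B}^n$, and any $\eta>0$, we have $$f+\eta\in Q(\mathrm{B}^n)_{(r+1)n}\quad\text{for all integers } r\ge\max\Big\{\pi d\sqrt{2n},\ \frac{1}{\sqrt{\eta}}\sqrt{C(n,d)\,(f_{\max}-f_{\min})}\Big\}.$$ Hence $f+\eta\in Q(\mathrm{B}^n)_r$ for some $r=O(1/\sqrt{\eta})$; that is, for each such $f$ there is a constant $A>0$ (depending on $f$ and $n$ but not on $\eta$) such that for every $\eta\in(0,1]$ there is an integer $r\le A/\sqrt{\eta}$ with $f+\eta\in Q(\mathrm{B}^n)_r$.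
   Context: $\mathbb{N}=\{0,1,2,\dots\}$, $[n]=\{1,\dots,n\}$, $\mathbb{R}[\mathbf{x}]=\mathbb{R}[x_1,\dots,x_n]$. $\mathrm{B}^n=[-1,1]^n\subseteq\mathbb{R}^n$. For a polynomial $f$, $f_{\min}$ and $f_{\max}$ denote its minimum and maximum over $\mathrm{B}^n$. $\Sigma[\mathbf{x}]$ is the set of sums of squares of polynomials in $\mathbb{R}[\mathbf{x}]$. Set $g_i(\mathbf{x})=1-x_i^2$ for $i\in[n]$ and $g_J=\prod_{j\in J}g_j$ for $J\subseteq[n]$ (with $g_\emptyset=1$). The preordering truncated at degree $r$ is $$Q(\mathrm{B}^n)_r=\Big\{\sum_{J\subseteq[n]}\sigma_Jg_J:\ \sigma_J\in\Sigma[\mathbf{x}],\ \deg(\sigma_Jg_J)\le r\Big\}$$ (each individual summand has degree at most $r$). The lower bound is $f_{(r)}=\max\{\lambda\in\mathbb{R}: f-\lambda\in Q(\mathrm{B}^n)_r\}$; the maximum is attained if the program is feasible, and $f_{(r)}=-\infty$ if it is infeasible. *)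

(* Defs.v *)
From HB Require Import structures.
From mathcomp Require Import all_boot all_order all_algebra.
From mathcomp Require Import boolp classical_sets reals ereal trigo.
(* The notations of mpoly clash with those of mathcomp-analysis, so only its
   constants and canonical instances are imported; the two notations that are
   needed are redeclared below. *)
From mathcomp Require mpoly.
Import -(notations) mpoly.

Set Implicit Arguments.
Unset Strict Implicit.
Unset Printing Implicit Defensive.

Import Order.TTheory GRing.Theory Num.Theory.
Local Open Scope classical_set_scope.
Local Open Scope ring_scope.

Notation "{ 'mpoly' T [ n ] }" := (mpoly n T)
  (at level 0, T at level 2, format "{ 'mpoly'  T [ n ] }") : type_scope.
Notation "c %:MP" := (mpolyC _ c)
  (at level 1, format "c %:MP") : ring_scope.

(* Total degree, with the convention that the zero polynomial has degree 0
   (mmeasure mdeg is the total degree plus one, and 0 on the zero polynomial). *)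
Definition tdeg (R : realType) (n : nat) (p : {mpoly R[n]}) : nat :=
  (mmeasure mdeg p).-1.

Definition box (R : realType) (n : nat) : set ('I_n -> R) :=
  [set x | forall i, -1 <= x i <= 1].
Arguments box : clear implicits.

(* The box is nonempty and compact and polynomials are continuous, so the
   infimum and supremum below are a minimum and a maximum. *)
Definition box_min (R : realType) (n : nat) (p : {mpoly R[n]}) : R :=
  inf [set meval x p | x in box R n].

Definition box_max (R : realType) (n : nat) (p : {mpoly R[n]}) : R :=
  sup [set meval x p | x in box R n].

Definition is_sos (R : realType) (n : nat) (p : {mpoly R[n]}) : Prop :=
  exists s : seq {mpoly R[n]}, p = \sum_(q <- s) q ^+ 2.

Definition box_g (R : realType) (n : nat) (i : 'I_n) : {mpoly R[n]} :=
  1 - mpolyX R (mnm1 i) ^+ 2.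

Definition box_gJ (R : realType) (n : nat) (J : {set 'I_n}) : {mpoly R[n]} :=
  \prod_(j in J) box_g R j.

Definition preordering (R : realType) (n r : nat) : set {mpoly R[n]} :=
  [set p | exists sigma : {set 'I_n} -> {mpoly R[n]},
     (forall J, is_sos (sigma J) /\ (tdeg (sigma J * box_gJ R J)%R <= r)%N)
     /\ p = \sum_(J : {set 'I_n}) sigma J * box_gJ R J].
Arguments preordering : clear implicits.

(* The supremum is -oo when no lambda is feasible; otherwise it is finite and
   attained, the truncated preordering being closed. *)
Definition lower_bound (R : realType) (n r : nat) (p : {mpoly R[n]}) : \bar R :=
  ereal_sup [set lambda%:E | lambda in
    [set lambda : R | preordering R n r (p - lambda%:MP)]].

Definition rate_constant (R : realType) (n d : nat) (C : R) : Prop :=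
  forall (h : {mpoly R[n]}) (r : nat),
    tdeg h = d -> (1 <= r)%N -> @pi R * d%:R * Num.sqrt (2 * n%:R) <= r%:R ->
    ((box_min h)%:E - lower_bound (r.+1 * n) h
       <= (C / r%:R ^+ 2 * (box_max h - box_min h))%:E)%E.

(* Main.v *)
Require Import Defs.
From HB Require Import structures.
From mathcomp Require Import all_boot all_order all_algebra.
From mathcomp Require Import boolp classical_sets reals ereal trigo.
From mathcomp Require Import topology function_spaces normedtype derive.
From mathcomp Require mpoly.
Import -(notations) mpoly.
From mathcomp Require Import ring lra zify.

Import Order.TTheory GRing.Theory Num.Theory numFieldNormedType.Exports.
Local Open Scope classical_set_scope.
Local Open Scope ring_scope.

Set Implicit Arguments.
Unset Strict Implicit.
Unset Printing Implicit Defensive.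

(** Let [chebT x k] and [chebS x k] be the polynomials with
    [cos (k t) = chebT (cos t) k] and [sin (k t) = sin t * chebS (cos t) k], and
    let [mcheb a] be the product of the [chebT x_i (a i)].

    Convergence rate.  For weights [w_j] the univariate polynomial
    [K(x, y) = sum_(j, k) w_j w_k T_|j-k|(x) T_|j-k|(y)] is, with [x = cos t] and
    [y = cos u], the mean of [|sum_j w_j e^(ij(t-u))|^2] and
    [|sum_j w_j e^(ij(t+u))|^2].  Separating real and imaginary parts exhibits it,
    for each fixed [y] in [-1, 1], as a sum of squares plus [1 - x^2] times a sum
    of squares ([tent_kernel], [tent_kernelE]).  Hence, for [p] nonnegative on the
    box, the average over a grid of Chebyshev nodes [y] of [p(y) prod_i K(x_i, y_i)]
    lies in the preordering ([preordering_kernel_op]).  Discrete orthogonality makes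
    this averaging operator diagonal in the basis [mcheb a] ([kernel_op_mcheb]), and
    the tent weights [w_j = min(j, N - j)] give eigenvalues [Lambda_a] with
    [1 - Lambda_a = O(1 / N^2)] ([tent_corr_ratio]): they are autocorrelations of
    a Lipschitz sequence whose square sum is of order [N^3].

    If [p = sum_a c_a mcheb a] is the Chebyshev expansion and [A p] the average,
    then [p + eps = A p + sum_a (e + c_a (1 - Lambda_a) mcheb a)], where
    [eps = sum_a e].  The [c_a] are bounded by the maximum of [p], by quadrature
    ([mcheb_coeff_bound]), so [e = O(1 / N^2)] can dominate every
    [c_a (1 - Lambda_a)], and [e + c mcheb a] with [|c| <= e] has an explicit
    certificate because [1 - T_k^2 = (1 - x^2) S_k^2] ([preordering_mcheb]).  This
    is [preordering_perturb]; with [N] proportional to [r] it yields a rate constant.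

    Membership for a given constant.  If [C] is a rate constant, the lower bound of
    [f] is at least [- eta] when [r] is large, but it may be equal to [- eta], and
    then [f + eta] is in the truncated preordering only because the supremum
    defining the lower bound is attained ([preordering_max_attained]).  Planar
    rotations shorten any sum of squares to as many squares as there are monomials
    ([sos_shorten]), so that certificates are points of a fixed product of lines.
    The values of a certificate at the nodes, which are interior points of the box,
    bound its coefficients, and the certificates of all large enough [lambda] form
    a compact set, over which [lambda] attains its maximum.

    The order [O(1 / sqrt eta)] follows by rounding up the threshold for [r]. *)

(** * Chebyshev polynomials and the kernel *)

(** The recursion is that of [(x + i sqrt(1 - x^2))^k = T_k + i sqrt(1 - x^2)
    S_k]; it makes sense in any commutative ring, so that the same identities
    serve for reals and for polynomials. *)
Fixpoint chebTS (A : comNzRingType) (x : A) (k : nat) : A * A :=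
  if k is k'.+1 then
    let ts := chebTS x k' in
    (x * ts.1 - (1 - x ^+ 2) * ts.2, ts.1 + x * ts.2)
  else (1, 0).

Definition chebT (A : comNzRingType) (x : A) (k : nat) : A := (chebTS x k).1.
Definition chebS (A : comNzRingType) (x : A) (k : nat) : A := (chebTS x k).2.

Lemma chebT0 (A : comNzRingType) (x : A) : chebT x 0 = 1.
Proof. by []. Qed.

Lemma chebS0 (A : comNzRingType) (x : A) : chebS x 0 = 0.
Proof. by []. Qed.

Lemma chebTr (A : comNzRingType) (x : A) k :
  chebT x k.+1 = x * chebT x k - (1 - x ^+ 2) * chebS x k.
Proof. by []. Qed.

Lemma chebSr (A : comNzRingType) (x : A) k :
  chebS x k.+1 = chebT x k + x * chebS x k.
Proof. by []. Qed.

Lemma chebT1 (A : comNzRingType) (x : A) : chebT x 1 = x.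
Proof. by rewrite chebTr chebT0 chebS0 mulr1 mulr0 subr0. Qed.

Lemma cheb_pythagoras (A : comNzRingType) (x : A) k :
  chebT x k ^+ 2 + (1 - x ^+ 2) * chebS x k ^+ 2 = 1.
Proof.
elim: k => [|k IH]; first by rewrite chebT0 chebS0; ring.
by rewrite -[RHS]IH chebTr chebSr; ring.
Qed.

(** Addition formulas of cosine and sine. *)
Lemma chebD (A : comNzRingType) (x : A) j k :
  chebT x (j + k) = chebT x j * chebT x k - (1 - x ^+ 2) * chebS x j * chebS x k
  /\ chebS x (j + k) = chebS x j * chebT x k + chebT x j * chebS x k.
Proof.
elim: k => [|k [IHT IHS]].
  by rewrite addn0 chebT0 chebS0; split; ring.
by rewrite addnS !chebTr !chebSr IHT IHS; split; ring.
Qed.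

(** Cosine of a difference.  The natural number [j - k + (k - j)] is the
    distance of [j] and [k], as one of the truncated differences vanishes. *)
Lemma chebT_dist (A : comNzRingType) (x : A) j k :
  chebT x (j - k + (k - j)) =
  chebT x j * chebT x k + (1 - x ^+ 2) * chebS x j * chebS x k.
Proof.
wlog le_kj : j k / (k <= j)%N => [IH|].
  case/orP: (leq_total k j) => [/IH //|/IH H].
  by rewrite addnC H; ring.
have /eqP -> : (k - j == 0)%N by rewrite subn_eq0.
have [HT HS] := chebD x (j - k) k.
rewrite addn0 -[LHS]mulr1 -[X in _ * X = _](cheb_pythagoras x k).
by rewrite -{2 3}(subnK le_kj) HT HS; ring.
Qed.

Lemma chebT_mul2 (A : comNzRingType) (x : A) j k :
  2 * (chebT x j * chebT x k) = chebT x (j + k) + chebT x (j - k + (k - j)).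
Proof. by rewrite chebT_dist (proj1 (chebD x j k)); ring. Qed.

Lemma rmorph_cheb (A B : comNzRingType) (phi : {rmorphism A -> B}) (x : A) k :
  phi (chebT x k) = chebT (phi x) k /\ phi (chebS x k) = chebS (phi x) k.
Proof.
elim: k => [|k [IHT IHS]]; first by rewrite !chebT0 !chebS0 rmorph1 rmorph0.
by rewrite !chebTr !chebSr expr2 !(rmorphB, rmorphD, rmorphM, rmorph1) /= IHT IHS.
Qed.

Lemma chebT_cos (R : realType) (t : R) k :
  chebT (cos t) k = cos (k%:R * t) /\ sin t * chebS (cos t) k = sin (k%:R * t).
Proof.
elim: k => [|k [IHT IHS]]; first by rewrite chebT0 chebS0 mul0r cos0 sin0 mulr0.
have -> : k.+1%:R * t = k%:R * t + t by rewrite -natr1 mulrDl mul1r.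
rewrite chebTr chebSr cosD sinD -IHT -IHS.
by rewrite -sin2cos2; split; ring.
Qed.

Lemma chebT_le1 (R : realType) (x : R) k : -1 <= x <= 1 -> `|chebT x k| <= 1.
Proof.
move=> /andP[x1 x2]; rewrite -(@ler_pXn2r _ 2) ?nnegrE //.
rewrite real_normK ?num_real // expr1n -(cheb_pythagoras x k) lerDl.
by rewrite mulr_ge0 ?sqr_ge0 //; nra.
Qed.

(** The tent function on [0, N], extended by zero thanks to truncated
    subtraction. *)
Definition tent (N j : nat) : nat := minn j (N - j).

Definition tent_sum (A : comNzRingType) (N : nat) (u v : nat -> A) : A :=
  \sum_(j < N) (tent N j)%:R * u j * v j.

(** With [x = cos t] and [y = cos u], the four sums are, up to factors [sin t]
    and [sin u], the [w]-weighted sums of the products of cosines and sines of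
    [j t] and [j u].  In this form the kernel is visibly a certificate of
    nonnegativity on [-1, 1] in [x], for each [y] in [-1, 1]. *)
Definition tent_kernel (A : comNzRingType) (N : nat) (x y : A) : A :=
  tent_sum N (chebT x) (chebT y) ^+ 2
  + (1 - y ^+ 2) * tent_sum N (chebT x) (chebS y) ^+ 2
  + (1 - x ^+ 2) * (tent_sum N (chebS x) (chebT y) ^+ 2
                    + (1 - y ^+ 2) * tent_sum N (chebS x) (chebS y) ^+ 2).

(** Expanding the squares, the coefficient of [w_j w_k] is [cos (jt) cos (kt) +
    sin (jt) sin (kt)] times the same expression in [u]. *)
Lemma tent_kernelE (A : comNzRingType) N (x y : A) :
  tent_kernel N x y = \sum_(j < N) \sum_(k < N)
    (tent N j * tent N k)%:R *
    (chebT x (j - k + (k - j)) * chebT y (j - k + (k - j))).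
Proof.
have sq (u v : nat -> A) : tent_sum N u v ^+ 2 = \sum_(j < N) \sum_(k < N)
    (tent N j * tent N k)%:R * (u j * v j * (u k * v k)).
  rewrite expr2 /tent_sum big_distrlr /=; apply: eq_bigr => j _.
  by apply: eq_bigr => k _; rewrite natrM; ring.
rewrite /tent_kernel !sq !mulr_sumr -!big_split /= mulr_sumr -!big_split /=.
apply: eq_bigr => j _; rewrite !mulr_sumr -!big_split /= mulr_sumr -big_split /=.
by apply: eq_bigr => k _; rewrite !chebT_dist; ring.
Qed.

(** * Chebyshev nodes and discrete orthogonality *)

(** The roots of [chebT x N]. *)
Definition cheb_node (R : realType) (N j : nat) : R :=
  cos ((2 * j%:R + 1) * (pi / (2 * N%:R))).

Arguments cheb_node : clear implicits.

Lemma cheb_node_itv (R : realType) N j : -1 <= cheb_node R N j <= 1.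
Proof. by rewrite cos_geN1 cos_le1. Qed.

Lemma cheb_node_lt1 (R : realType) N j : (j < N)%N ->
  0 < 1 - cheb_node R N j ^+ 2.
Proof.
move=> jN; rewrite -sin2cos2 exprn_gt0 // sin_gt0_pi //.
have N0 : 0 < N%:R :> R by rewrite ltr0n; lia.
have pi0 := pi_gt0 R.
have jN' : j.+1%:R <= N%:R :> R by rewrite ler_nat.
have j0 := ler0n R j.
set a := pi / _.
have a0 : 0 < a by rewrite divr_gt0 ?mulr_gt0.
have -> : pi = 2 * N%:R * a by rewrite /a; field; rewrite lt0r_neq0.
by rewrite mulr_gt0 //= ?ltr_pM2r //; move: jN'; rewrite -natr1; lra.
Qed.

(** After multiplication by [2 sin h], where [h] is half the angular step times
    [k], the sum telescopes to [sin (k pi) - sin 0]. *)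
Lemma cheb_node_sum (R : realType) N k : (0 < k < 2 * N)%N ->
  \sum_(j < N) chebT (cheb_node R N j) k = 0.
Proof.
move=> /andP[k0 k2N].
have N0 : 0 < N%:R :> R by rewrite ltr0n; lia.
set h : R := k%:R * (pi / (2 * N%:R)).
have sh : 0 < sin h.
  apply: sin_gt0_pi; rewrite /h.
  have pi0 := pi_gt0 R.
  rewrite mulr_gt0 ?ltr0n ?divr_gt0 ?mulr_gt0 //=.
  rewrite mulrA ltr_pdivrMr ?mulr_gt0 // mulrC ltr_pM2l //.
  by rewrite -(natrM _ 2) ltr_nat.
apply: (mulfI (lt0r_neq0 sh)); rewrite mulr0.
apply: (@mulfI _ 2); rewrite ?pnatr_eq0 // mulr0 !mulr_sumr.
pose s (j : nat) := sin (2 * j%:R * h).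
rewrite (eq_bigr (fun j : 'I_N => s j.+1 - s j)) => [|j _]; last first.
  rewrite (proj1 (chebT_cos _ _)) /s.
  have -> : k%:R * ((2 * j%:R + 1) * (pi / (2 * N%:R))) = (2 * j%:R + 1) * h.
    by rewrite /h; ring.
  have -> : 2 * j.+1%:R * h = (2 * j%:R + 1) * h + h by rewrite -natr1; ring.
  have -> : 2 * j%:R * h = (2 * j%:R + 1) * h - h by ring.
  by rewrite sinD sinB; ring.
rewrite -(big_mkord xpredT (fun j => s j.+1 - s j)) telescope_sumr // /s.
rewrite mulr0 mul0r sin0 subr0.
have -> : 2 * N%:R * h = k%:R * pi by rewrite /h; field; rewrite lt0r_neq0.
elim: k {k0 k2N h sh s} => [|k IH]; first by rewrite mul0r sin0.
by rewrite -natr1 mulrDl mul1r sinDpi IH oppr0.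
Qed.

Lemma cheb_node_orth (R : realType) N a b : (a < N)%N -> (b < N)%N ->
  \sum_(j < N) chebT (cheb_node R N j) a * chebT (cheb_node R N j) b =
  N%:R * ((a == b)%:R * (if b == 0%N then 1 else 2^-1)).
Proof.
move=> aN bN; have n2 : 2 != 0 :> R by rewrite pnatr_eq0.
apply: (mulfI n2); rewrite mulr_sumr.
under eq_bigr => j _ do rewrite chebT_mul2.
rewrite big_split /=.
have [->|ab] := eqVneq a b; last first.
  by rewrite !cheb_node_sum; [rewrite mul0r !mulr0 addr0|lia|lia].
have [->|b0] := eqVneq b 0%N.
  have E : \sum_(j < N) chebT (cheb_node R N j) 0 = N%:R.
    by under eq_bigr => j _ do rewrite chebT0; rewrite sumr_const card_ord.
  by rewrite subn0 !addn0 E mul1r mulr1; ring.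
rewrite cheb_node_sum ?add0r; last by lia.
under eq_bigr => j _ do rewrite subnn chebT0.
by rewrite sumr_const card_ord mul1r; field.
Qed.

(** The eigenvalue of the mean over the nodes on [chebT x l], before
    normalization: [1] and [1/2] are the mean squares of [T_0] and of the other
    [T_l] over the nodes. *)
Definition tent_corr (R : realType) (N l : nat) : R :=
  \sum_(j < N) \sum_(k < N) (tent N j * tent N k)%:R *
    ((j - k + (k - j) == l)%N%:R * (if l == 0%N then 1 else 2^-1)).

Arguments tent_corr : clear implicits.

(** The ring morphism [phi] allows [x] to be an indeterminate while the nodes
    are scalars. *)
Lemma tent_kernel_reproducing (R : realType) (A : comNzRingType)
    (phi : {rmorphism R -> A}) (x : A) N l : (l < N)%N ->
  \sum_(i < N) tent_kernel N x (phi (cheb_node R N i))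
              * phi (chebT (cheb_node R N i) l) =
  phi (N%:R * tent_corr R N l) * chebT x l.
Proof.
move=> lN.
under eq_bigr => i _ do rewrite tent_kernelE mulr_suml.
rewrite exchange_big /tent_corr mulr_sumr rmorph_sum mulr_suml /=.
apply: eq_bigr => j _.
under eq_bigr => i _ do rewrite mulr_suml.
rewrite exchange_big mulr_sumr rmorph_sum mulr_suml /=.
apply: eq_bigr => k _; set m := (j - k + (k - j))%N.
have mN : (m < N)%N by rewrite /m; have := ltn_ord j; have := ltn_ord k; lia.
under eq_bigr => i _ do
  rewrite -(proj1 (rmorph_cheb phi _ _)) -!mulrA -rmorphM.
rewrite -!mulr_sumr -rmorph_sum cheb_node_orth //.
rewrite -(rmorph_nat phi (tent N j * tent N k)).
have [->|_] := eqVneq m l; last by rewrite !(mul0r, mulr0, rmorph0).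
by rewrite !rmorphM; ring.
Qed.

(** * Autocorrelation of the tent weights *)

Lemma tent_pick (R : realType) N m :
  \sum_(k < N) (tent N k)%:R * (k == m :> nat)%:R = (tent N m)%:R :> R.
Proof.
have [mN|Nm] := ltnP m N.
  rewrite (bigD1 (Ordinal mN)) //= eqxx mulr1 big1 ?addr0 // => k.
  by rewrite -val_eqE /= => /negbTE ->; rewrite mulr0.
rewrite big1 => [|k _]; last first.
  by rewrite (_ : (k == m :> nat) = false) ?mulr0 //; have := ltn_ord k; lia.
by rewrite /tent (_ : minn m (N - m) = 0%N) //; lia.
Qed.

(** The pairs at distance [l > 0] come in two symmetric families, which
    compensates the factor [1/2]. *)
Lemma tent_corrE (R : realType) N l :
  tent_corr R N l = \sum_(j < N) (tent N j * tent N (j + l))%:R.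
Proof.
pose S := \sum_(j < N) \sum_(k < N)
  (tent N j * tent N k)%:R * (k == j + l :> nat)%N%:R : R.
have <- : S = \sum_(j < N) (tent N j * tent N (j + l))%:R.
  apply: eq_bigr => j _; rewrite natrM -(tent_pick R N (j + l)) mulr_sumr.
  by apply: eq_bigr => k _; rewrite natrM mulrA.
rewrite /tent_corr /S; have [->|l0] := eqVneq l 0%N.
  apply: eq_bigr => j _; apply: eq_bigr => k _; rewrite mulr1 addn0.
  by congr (_ * _%:R); congr nat_of_bool; lia.
suff H : \sum_(j < N) \sum_(k < N) (tent N j * tent N k)%:R *
    (j - k + (k - j) == l)%N%:R = S + S.
  have -> : \sum_(j < N) \sum_(k < N)
      (tent N j * tent N k)%:R * (k == j + l :> nat)%N%:R = 2^-1 * (S + S).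
    by rewrite -/S; field.
  rewrite -H mulr_sumr; apply: eq_bigr => j _.
  by rewrite mulr_sumr; apply: eq_bigr => k _; field.
rewrite {2}/S [X in _ = _ + X]exchange_big /= /S -big_split; apply: eq_bigr => j _.
rewrite -big_split; apply: eq_bigr => k _ /=; rewrite (mulnC (tent N k)).
rewrite -mulrDr; congr (_ * _).
by rewrite -natrD; congr (_%:R); lia.
Qed.

Lemma tent_corr_ge0 (R : realType) N l : 0 <= tent_corr R N l.
Proof. by rewrite tent_corrE; apply: sumr_ge0. Qed.

(** A square sum exceeds an autocorrelation by half the square sum of the
    differences; the second term appears because the shifted sequence loses its
    first [l] entries. *)
Lemma tent_corr_defect (R : realType) N l : (l <= N)%N ->
  2 * (tent_corr R N 0 - tent_corr R N l) =
  \sum_(j < N) ((tent N (j + l))%:R - (tent N j)%:R) ^+ 2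
  + \sum_(j < l) (tent N j)%:R ^+ 2.
Proof.
move=> lN; pose w j := (tent N j)%:R : R.
have sq : tent_corr R N 0 = \sum_(j < N) w j ^+ 2.
  by rewrite tent_corrE; apply: eq_bigr => j _; rewrite addn0 natrM expr2.
have sh : \sum_(j < N) w (j + l)%N ^+ 2 + \sum_(j < l) w j ^+ 2 = tent_corr R N 0.
  rewrite sq addrC -!(big_mkord xpredT (fun j => w j ^+ 2)).
  have -> : \sum_(j < N) w (j + l)%N ^+ 2 = \sum_(l <= j < N + l) w j ^+ 2.
    by rewrite -[X in \sum_(X <= _ < _) _](add0n l) big_addn addnK big_mkord.
  rewrite -big_cat_nat ?leq_addl //= (big_cat_nat (n := N)) ?leq_addr //=.
  rewrite [X in _ + X]big_nat [X in _ + X]big1 ?addr0 // => j /andP[Nj _].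
  by rewrite /w /tent (_ : minn j (N - j) = 0%N) ?expr0n //; lia.
have corr : tent_corr R N l = \sum_(j < N) w j * w (j + l)%N.
  by rewrite tent_corrE; apply: eq_bigr => j _; rewrite natrM.
have -> : \sum_(j < N) ((tent N (j + l))%:R - (tent N j)%:R) ^+ 2
    = \sum_(j < N) w (j + l)%N ^+ 2 + tent_corr R N 0 - 2 * tent_corr R N l.
  rewrite sq corr mulr_sumr -sumrN -!big_split; apply: eq_bigr => j _ /=.
  by rewrite /w; ring.
by rewrite -/(w _) -[X in _ = _ + X - _ + _]sh; rewrite -sh; ring.
Qed.

Lemma tent_lip N j l :
  (tent N (j + l) <= tent N j + l)%N /\ (tent N j <= tent N (j + l) + l)%N.
Proof. by rewrite /tent; split; lia. Qed.

Lemma tent_corr_gap (R : realType) N l : (l <= N)%N ->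
  tent_corr R N l <= tent_corr R N 0 <= tent_corr R N l + (N * l ^ 2)%:R.
Proof.
move=> lN; have := tent_corr_defect R lN.
set S1 := \sum_(j < N) _; set S2 := \sum_(j < l) _ => E.
have S1_ge0 : 0 <= S1 by apply: sumr_ge0 => j _; apply: sqr_ge0.
have S2_ge0 : 0 <= S2 by apply: sumr_ge0 => j _; apply: sqr_ge0.
have S1_le : S1 <= (N * l ^ 2)%:R.
  rewrite natrM mulr_natl -[X in _ *+ X](card_ord N) -sumr_const.
  apply: ler_sum => j _; rewrite natrX -[leRHS]real_normK ?num_real //.
  rewrite -[leLHS]real_normK ?num_real // lerXn2r ?nnegrE // [leRHS]ger0_norm //.
  have [H1 H2] := tent_lip N j l.
  rewrite ler_norml; apply/andP; split.
    by rewrite lerNl opprB lerBlDl -natrD ler_nat.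
  by rewrite lerBlDl -natrD ler_nat.
have S2_le : S2 <= (N * l ^ 2)%:R.
  apply: (@le_trans _ _ (l * l ^ 2)%:R); last by rewrite ler_nat leq_mul2r lN orbT.
  rewrite natrM mulr_natl -[X in _ *+ X](card_ord l) -sumr_const.
  apply: ler_sum => j _; rewrite natrX lerXn2r ?nnegrE // ler_nat /tent.
  by have := ltn_ord j; lia.
by apply/andP; split; lra.
Qed.

(** The ascending half of the tent already contributes [1^2 + ... + M^2]. *)
Lemma tent_corr0_ge (R : realType) M : (M ^ 3)%:R <= 3 * tent_corr R (2 * M) 0.
Proof.
case: M => [|M]; first by rewrite mulr_ge0 ?tent_corr_ge0.
pose w j := (tent (2 * M.+1) j)%:R : R.
have E : tent_corr R (2 * M.+1) 0 = \sum_(j < 2 * M.+1) w j ^+ 2.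
  by rewrite tent_corrE; apply: eq_bigr => j _; rewrite addn0 natrM expr2.
have le1 : \sum_(i < M.+2) (i%:R ^+ 2 : R) <= tent_corr R (2 * M.+1) 0.
  rewrite E -(big_mkord xpredT (fun j => w j ^+ 2)).
  rewrite (big_cat_nat (n := M.+2)) //=; last by lia.
  rewrite big_mkord -[leLHS]addr0 lerD ?sumr_ge0 // => [|j _]; last exact: sqr_ge0.
  apply: ler_sum => j _; rewrite /w /tent.
  by rewrite (_ : minn j _ = j) //; have := ltn_ord j; lia.
apply: le_trans (ler_wpM2l _ le1); rewrite ?ler0n //.
elim: M.+1 => [|m IH]; first by rewrite mulr_ge0 // sumr_ge0 // => i _; apply: sqr_ge0.
rewrite big_ord_recr /= mulrDr.
apply: le_trans (lerD IH (lexx _)).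
by rewrite -natrX -!natrM -natrD ler_nat; lia.
Qed.

(** * Degrees, sums of squares and the truncated preordering *)

Lemma tdeg_leE (R : realType) n (p : {mpoly R[n]}) k :
  (tdeg p <= k)%N = (mmeasure mdeg p <= k.+1)%N.
Proof. by rewrite /tdeg; case: mmeasure. Qed.

Lemma tdegD_le (R : realType) n (p q : {mpoly R[n]}) k :
  (tdeg p <= k)%N -> (tdeg q <= k)%N -> (tdeg (p + q)%R <= k)%N.
Proof.
rewrite !tdeg_leE => pk qk.
by rewrite (leq_trans (mmeasureD_le _ _ _)) // geq_max pk.
Qed.

Lemma tdegC (R : realType) n (c : R) : tdeg (c%:MP : {mpoly R[n]}) = 0%N.
Proof. by rewrite /tdeg mmeasureC; case: eqP. Qed.

Lemma tdegN (R : realType) n (p : {mpoly R[n]}) : tdeg (- p) = tdeg p.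
Proof. by rewrite /tdeg mmeasureN. Qed.

Lemma tdegM_le (R : realType) n (p q : {mpoly R[n]}) k l :
  (tdeg p <= k)%N -> (tdeg q <= l)%N -> (tdeg (p * q)%R <= k + l)%N.
Proof.
have [->|p0] := eqVneq p 0; first by rewrite mul0r -(mpolyC0 n R) tdegC.
have [->|q0] := eqVneq q 0; first by rewrite mulr0 -(mpolyC0 n R) tdegC.
rewrite !tdeg_leE msizeM //.
by move: (mmeasure _ p) (mmeasure _ q) => a b; lia.
Qed.

Lemma tdeg_sum_le (R : realType) n (I : Type) (s : seq I) (P : pred I)
    (F : I -> {mpoly R[n]}) k :
  (forall i, P i -> (tdeg (F i) <= k)%N) -> (tdeg (\sum_(i <- s | P i) F i)%R <= k)%N.
Proof.
move=> H; elim/big_ind: _ => [|p q|i /H //]; last exact: tdegD_le.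
by rewrite -(mpolyC0 n R) tdegC.
Qed.

Lemma tdegU (R : realType) n (i : 'I_n) : tdeg (mpolyX R (mnm1 i)) = 1%N.
Proof. by rewrite /tdeg mmeasureX /= mdeg1. Qed.

Lemma tdeg_box_g (R : realType) n (i : 'I_n) : (tdeg (box_g R i) <= 2)%N.
Proof.
apply: tdegD_le; first by rewrite -(mpolyC1 n R) tdegC.
by rewrite tdegN expr2 (@tdegM_le _ _ _ _ 1 1) // tdegU.
Qed.

Lemma sos_sqr (R : realType) n (p : {mpoly R[n]}) : is_sos (p ^+ 2).
Proof. by exists [:: p]; rewrite big_seq1. Qed.

Lemma sosD (R : realType) n (p q : {mpoly R[n]}) :
  is_sos p -> is_sos q -> is_sos (p + q).
Proof. by move=> [s ->] [t ->]; exists (s ++ t); rewrite big_cat. Qed.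

Lemma sosM (R : realType) n (p q : {mpoly R[n]}) :
  is_sos p -> is_sos q -> is_sos (p * q).
Proof.
move=> [s ->] [t ->]; exists [seq x * y | x <- s, y <- t].
rewrite big_allpairs_dep mulr_suml; apply: eq_bigr => x _.
by rewrite mulr_sumr; apply: eq_bigr => y _; rewrite exprMn.
Qed.

Lemma sosC (R : realType) n (c : R) : 0 <= c -> is_sos (c%:MP : {mpoly R[n]}).
Proof.
by move=> c0; rewrite -(sqr_sqrtr c0) rmorphXn; apply: sos_sqr.
Qed.

Lemma box_gJ0 (R : realType) n : box_gJ R (finset.set0 : {set 'I_n}) = 1.
Proof. by rewrite /box_gJ big_set0. Qed.

(** Multiplicativity of the preordering rests on this: common factors of two
    products of constraints are squares. *)
Lemma box_gJM (R : realType) n (J K : {set 'I_n}) :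
  box_gJ R J * box_gJ R K =
  box_gJ R (J :&: K) ^+ 2 * box_gJ R ((J :\: K) :|: (K :\: J)).
Proof.
have split_set (A B : {set 'I_n}) :
    box_gJ R A = box_gJ R (A :&: B) * box_gJ R (A :\: B).
  by rewrite /box_gJ (big_setID B).
rewrite (split_set J K) (split_set K J) (finset.setIC K J) (split_set (_ :|: _) J).
have -> : ((J :\: K) :|: (K :\: J)) :&: J = J :\: K.
  by apply/setP => i; rewrite !finset.inE; case: (i \in J); case: (i \in K).
have -> : ((J :\: K) :|: (K :\: J)) :\: J = K :\: J.
  by apply/setP => i; rewrite !finset.inE; case: (i \in J); case: (i \in K).
by ring.
Qed.

Lemma preordering_gen (R : realType) n r (s : {mpoly R[n]}) J :
  is_sos s -> (tdeg (s * box_gJ R J)%R <= r)%N ->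
  preordering R n r (s * box_gJ R J).
Proof.
move=> s_sos sr; exists (fun K => if K == J then s else 0); split=> [K|].
  case: eqP => [-> //|_]; rewrite mul0r -(mpolyC0 n R) tdegC.
  by split=> //; apply: sosC.
rewrite (bigD1 J) //= eqxx big1 ?addr0 // => K /negbTE ->; exact: mul0r.
Qed.

Lemma preorderingD (R : realType) n r (p q : {mpoly R[n]}) :
  preordering R n r p -> preordering R n r q -> preordering R n r (p + q).
Proof.
move=> [s [Hs ->]] [t [Ht ->]]; exists (fun J => s J + t J); split=> [J|].
  have [[s1 s2] [t1 t2]] := (Hs J, Ht J).
  by split; [exact: sosD|rewrite mulrDl tdegD_le].
by rewrite -big_split; apply: eq_bigr => J _; rewrite mulrDl.
Qed.

Lemma preorderingC (R : realType) n r (c : R) :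
  0 <= c -> preordering R n r c%:MP.
Proof.
move=> c0; rewrite -[c%:MP]mulr1.
rewrite -(box_gJ0 R n).
apply: preordering_gen; first exact: sosC.
by rewrite box_gJ0 mulr1 tdegC.
Qed.

Lemma preordering_sum (R : realType) n r (I : Type) (s : seq I) (P : pred I)
    (F : I -> {mpoly R[n]}) :
  (forall i, P i -> preordering R n r (F i)) ->
  preordering R n r (\sum_(i <- s | P i) F i).
Proof.
move=> H; elim/big_ind: _ => [|p q|i /H //]; last exact: preorderingD.
by rewrite -(mpolyC0 n R); apply: preorderingC.
Qed.

Lemma preordering_weaken (R : realType) n r r' (p : {mpoly R[n]}) :
  (r <= r')%N -> preordering R n r p -> preordering R n r' p.
Proof.
move=> rr' [s [Hs ->]]; exists s; split=> // J.
by have [? le_r] := Hs J; split=> //; apply: leq_trans rr'.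
Qed.

Lemma preorderingM (R : realType) n r r' (p q : {mpoly R[n]}) :
  preordering R n r p -> preordering R n r' q -> preordering R n (r + r') (p * q).
Proof.
move=> [s [Hs ->]] [t [Ht ->]]; rewrite big_distrlr /=.
apply: preordering_sum => J _; apply: preordering_sum => K _.
have [[s1 s2] [t1 t2]] := (Hs J, Ht K).
have E : s J * box_gJ R J * (t K * box_gJ R K) =
    s J * t K * box_gJ R (J :&: K) ^+ 2 *
    box_gJ R ((J :\: K) :|: (K :\: J)).
  by rewrite -[RHS]mulrA -box_gJM; ring.
have degE := tdegM_le s2 t2; rewrite E in degE *.
apply: preordering_gen => //; apply: sosM; last exact: sos_sqr.
exact: sosM.
Qed.

Lemma preordering_prod (R : realType) n r k (F : 'I_k -> {mpoly R[n]}) :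
  (forall i, preordering R n r (F i)) ->
  preordering R n (r * k) (\prod_(i < k) F i).
Proof.
elim: k F => [|k IH] F H.
  by rewrite big_ord0 -(mpolyC1 n R); apply: preorderingC.
rewrite big_ord_recr mulnS addnC; apply: preorderingM => //; exact: IH.
Qed.

Lemma preorderingZ (R : realType) n r (c : R) (p : {mpoly R[n]}) :
  0 <= c -> preordering R n r p -> preordering R n r (c%:MP * p).
Proof.
move=> c0 pr; rewrite -[r]add0n; apply: preorderingM => //.
exact: preorderingC.
Qed.

Lemma preordering_sqr (R : realType) n r k (p : {mpoly R[n]}) :
  (tdeg p <= k)%N -> (k + k <= r)%N -> preordering R n r (p ^+ 2).
Proof.
move=> pk kr; apply: (preordering_weaken kr); rewrite -[p ^+ 2]mulr1.
rewrite -(box_gJ0 R n).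
apply: preordering_gen; first exact: sos_sqr.
by rewrite box_gJ0 mulr1 expr2 tdegM_le.
Qed.

Lemma preordering_g (R : realType) n (i : 'I_n) : preordering R n 2 (box_g R i).
Proof.
rewrite -[box_g R i]mul1r.
have -> : box_g R i = box_gJ R [set i] by rewrite /box_gJ big_set1.
apply: preordering_gen; first by rewrite -(mpolyC1 n R); apply: sosC.
by rewrite mul1r /box_gJ big_set1 tdeg_box_g.
Qed.

(** * Certificates for the kernel and for Chebyshev products *)

Definition mvar (R : realType) (n : nat) (i : 'I_n) : {mpoly R[n]} :=
  mpolyX R (mnm1 i).
Arguments mvar : clear implicits.

Definition mcheb (R : realType) (n : nat) (a : 'I_n -> nat) : {mpoly R[n]} :=
  \prod_(i < n) chebT (mvar R n i) (a i).
Arguments mcheb : clear implicits.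

(** The sharper bound for [chebS] compensates the degree of [1 - x^2] in the
    certificates below. *)
Lemma tdeg_cheb (R : realType) n (i : 'I_n) k :
  (tdeg (chebT (mvar R n i) k) <= k)%N /\ (tdeg (chebS (mvar R n i) k) <= k.-1)%N.
Proof.
have [t0 s0] : (tdeg (chebT (mvar R n i) 0) <= 0)%N /\
    (tdeg (chebS (mvar R n i) 0) <= 0)%N.
  by rewrite chebT0 chebS0 -(mpolyC0 n R) -(mpolyC1 n R) !tdegC.
case: k => [//|k]; elim: k => [|k [IHT IHS]].
  rewrite chebTr chebSr chebT0 chebS0 !mulr0 subr0 mulr1 addr0.
  by rewrite tdegU -(mpolyC1 n R) tdegC.
have X1 : (tdeg (mvar R n i) <= 1)%N by rewrite tdegU.
rewrite chebTr chebSr; split.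
  apply: tdegD_le; first by rewrite -[k.+2]add1n tdegM_le.
  by rewrite tdegN -[k.+2]/(2 + k)%N tdegM_le // (tdeg_box_g R i).
by apply: tdegD_le => //; rewrite /= -[k.+1]add1n tdegM_le.
Qed.

(** As [chebS] has degree one less than [chebT], both parts of the kernel have
    degree at most [2 (m + 1)]. *)
Lemma preordering_tent_kernel (R : realType) n m (i : 'I_n) (y : R) :
  -1 <= y <= 1 ->
  preordering R n (m.+1 + m.+1) (tent_kernel m.+2 (mvar R n i) y%:MP).
Proof.
move=> /andP[y1 y2].
have y0 : 0 <= 1 - y ^+ 2 by nra.
have yC k : chebT (y%:MP : {mpoly R[n]}) k = (chebT y k)%:MP /\
    chebS (y%:MP : {mpoly R[n]}) k = (chebS y k)%:MP.
  by have [-> ->] := rmorph_cheb (@mpolyC n R) y k.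
have deg_tent_sum k (u v : nat -> {mpoly R[n]}) :
    (forall j, (j < m.+2)%N -> (tdeg (u j) <= k)%N) ->
    (forall j, tdeg (v j) = 0%N) -> (tdeg (tent_sum m.+2 u v) <= k)%N.
  move=> Hu Hv; apply: tdeg_sum_le => j _.
  rewrite -[k]addn0 tdegM_le ?Hv // -[k]add0n tdegM_le ?Hu //.
  by rewrite -(mpolyC_nat n R) tdegC.
have vT j : tdeg (chebT (y%:MP : {mpoly R[n]}) j) = 0%N.
  by rewrite (proj1 (yC j)) tdegC.
have vS j : tdeg (chebS (y%:MP : {mpoly R[n]}) j) = 0%N.
  by rewrite (proj2 (yC j)) tdegC.
have uT j : (j < m.+2)%N -> (tdeg (chebT (mvar R n i) j) <= m.+1)%N.
  by rewrite ltnS; apply: leq_trans; have [] := tdeg_cheb R i j.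
have uS j : (j < m.+2)%N -> (tdeg (chebS (mvar R n i) j) <= m)%N.
  by move=> jm; have [_ /leq_trans->//] := tdeg_cheb R i j; lia.
rewrite /tent_kernel.
have <- : (1 - y ^+ 2)%:MP = 1 - y%:MP ^+ 2 :> {mpoly R[n]}.
  by rewrite mpolyCB mpolyC1 rmorphXn.
apply: preorderingD; first apply: preorderingD.
- by apply: (preordering_sqr (k := m.+1)) => //; apply: deg_tent_sum.
- apply: preorderingZ => //.
  by apply: (preordering_sqr (k := m.+1)) => //; apply: deg_tent_sum.
rewrite (_ : (m.+1 + m.+1 = 2 + (m + m))%N); last by lia.
apply: preorderingM; first exact: preordering_g.
apply: preorderingD.
  by apply: (preordering_sqr (k := m)) => //; apply: deg_tent_sum.
apply: preorderingZ => //.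
by apply: (preordering_sqr (k := m)) => //; apply: deg_tent_sum.
Qed.

(** [1 - P^2 G^2 = (1 - P^2) + P^2 (1 - G^2)], iterated. *)
Lemma preordering_1Bsqr_prod (R : realType) n d k (F : 'I_k -> {mpoly R[n]}) :
  (forall i, (tdeg (F i) <= d)%N) ->
  (forall i, preordering R n (d + d) (1 - F i ^+ 2)) ->
  (tdeg (\prod_(i < k) F i)%R <= d * k)%N /\
  preordering R n ((d + d) * k) (1 - (\prod_(i < k) F i) ^+ 2).
Proof.
elim: k F => [|k IH] F degF QF.
  rewrite !big_ord0 expr1n subrr -(mpolyC0 n R) -(mpolyC1 n R) tdegC.
  by split=> //; apply: preorderingC.
rewrite !big_ord_recr /=.
have [|//|degP QP] := IH (fun i => F (widen_ord (leqnSn k) i)); first by [].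
split; first by rewrite mulnS addnC tdegM_le.
set P := \prod_(i < k) _ in degP QP *; set G := F _.
have -> : 1 - (P * G) ^+ 2 = (1 - P ^+ 2) + P ^+ 2 * (1 - G ^+ 2) by ring.
apply: preorderingD; first by apply: preordering_weaken QP; lia.
rewrite mulnS addnC; apply: preorderingM; last exact: QF.
by apply: (preordering_sqr degP); lia.
Qed.

(** [1 + S = ((1 + S)^2 + (1 - S^2)) / 2] applied to [S = T] or [S = - T],
    according to the sign of [c]. *)
Lemma preordering_addM (R : realType) n D (T : {mpoly R[n]}) (c e : R) :
  (tdeg T <= D)%N -> preordering R n (D + D) (1 - T ^+ 2) -> `|c| <= e ->
  preordering R n (D + D) (e%:MP + c%:MP * T).
Proof.
move=> degT QT ce.
have H (S : {mpoly R[n]}) : (tdeg S <= D)%N ->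
    preordering R n (D + D) (1 - S ^+ 2) -> preordering R n (D + D) (1 + S).
  move=> degS QS.
  have -> : 1 + S = (2^-1)%:MP * ((1 + S) ^+ 2 + (1 - S ^+ 2)).
    have h : (2^-1)%:MP * 2 = 1 :> {mpoly R[n]}.
      by rewrite -(mpolyC_nat n R 2) -mpolyCM mulVf ?mpolyC1 // pnatr_eq0.
    by rewrite -[LHS]mul1r -[X in X * _ = _]h; ring.
  apply: preorderingZ; first by rewrite invr_ge0.
  apply: preorderingD => //; apply: (preordering_sqr (k := D)) => //.
  by apply: tdegD_le; rewrite // -(mpolyC1 n R) tdegC.
have -> : e%:MP + c%:MP * T = (e - `|c|)%:MP + (`|c|%:MP + c%:MP * T).
  by rewrite mpolyCB; ring.
apply: preorderingD; first by apply: preorderingC; rewrite subr_ge0.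
have [c0|c0] := leP 0 c.
  rewrite ger0_norm // -[X in X + _]mulr1 -mulrDr; apply: preorderingZ => //.
  exact: H.
rewrite ltr0_norm // -{2}[c]opprK [(- - c)%:MP]mpolyCN mulNr -mulrN.
rewrite -[X in X + _]mulr1 -mulrDr; apply: preorderingZ; first by lra.
by apply: H; rewrite ?tdegN ?sqrrN.
Qed.

(** The base case is the Pythagorean identity [1 - T_k^2 = (1 - x^2) S_k^2]. *)
Lemma preordering_mcheb (R : realType) n d (a : 'I_n -> nat) (c e : R) :
  (forall i, (a i <= d)%N) -> `|c| <= e ->
  preordering R n ((d + d) * n) (e%:MP + c%:MP * mcheb R n a).
Proof.
move=> ad ce; set F := fun i => chebT (mvar R n i) (a i).
have degF i : (tdeg (F i) <= d)%N.
  by apply: leq_trans (ad i); have [] := tdeg_cheb R i (a i).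
have QF i : preordering R n (d + d) (1 - F i ^+ 2).
  have -> : 1 - F i ^+ 2 = box_g R i * chebS (mvar R n i) (a i) ^+ 2.
    rewrite -[X in X - _](cheb_pythagoras (mvar R n i) (a i)).
    by rewrite addrC addrA addNr add0r.
  case: (a i) (ad i) => [_|k kd].
    by rewrite chebS0 expr0n mulr0 -(mpolyC0 n R); apply: preorderingC.
  apply: (@preordering_weaken _ _ (2 + (k + k))); first by lia.
  apply: preorderingM; first exact: preordering_g.
  by apply: (preordering_sqr (k := k)) => //; have [] := tdeg_cheb R i k.+1.
have [degT QT] := preordering_1Bsqr_prod degF QF.
by rewrite mulnDl; apply: preordering_addM => //; rewrite -mulnDl.
Qed.

(** * Multivariate Chebyshev expansion *)

Definition cheb_span (R : realType) (n d : nat) (i : 'I_n) (p : {mpoly R[n]}) :=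
  exists b : 'I_d.+1 -> R, p = \sum_j (b j)%:MP * chebT (mvar R n i) j.

Lemma cheb_spanD (R : realType) n d i (p q : {mpoly R[n]}) :
  cheb_span d i p -> cheb_span d i q -> cheb_span d i (p + q).
Proof.
move=> [b ->] [c ->]; exists (fun j => b j + c j).
by rewrite -big_split; apply: eq_bigr => j _; rewrite mpolyCD mulrDl.
Qed.

Lemma cheb_spanZ (R : realType) n d i (a : R) (p : {mpoly R[n]}) :
  cheb_span d i p -> cheb_span d i (a%:MP * p).
Proof.
move=> [b ->]; exists (fun j => a * b j).
by rewrite mulr_sumr; apply: eq_bigr => j _; rewrite mpolyCM mulrA.
Qed.

Lemma cheb_spanT (R : realType) n d (i : 'I_n) k : (k <= d)%N ->
  cheb_span d i (chebT (mvar R n i) k).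
Proof.
rewrite -ltnS => kd; exists (fun j => (j == Ordinal kd)%:R).
rewrite (bigD1 (Ordinal kd)) //= eqxx mpolyC1 mul1r big1 ?addr0 // => j.
by move=> /negbTE ->; rewrite mpolyC0 mul0r.
Qed.

(** [x T_0 = T_1] and [2 x T_(l+1) = T_(l+2) + T_l]. *)
Lemma cheb_span_exp (R : realType) n d (i : 'I_n) k : (k <= d)%N ->
  cheb_span d i (mvar R n i ^+ k).
Proof.
elim: k d => [|k IH] d kd.
  by rewrite expr0 -(chebT0 (mvar R n i)); apply: cheb_spanT.
case: d kd => // d kd; have [b bE] := IH d kd; rewrite exprS bE mulr_sumr.
elim/big_ind: _ => [|p q|j _]; last 1 first.
- rewrite mulrCA; apply: cheb_spanZ; have jd := ltn_ord j.
  case: (nat_of_ord j) jd => [|l] ld.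
    rewrite chebT0 mulr1.
    by rewrite -[mvar R n i]chebT1; apply: cheb_spanT.
  have -> : mvar R n i * chebT (mvar R n i) l.+1 =
      (2^-1)%:MP * (chebT (mvar R n i) l.+2 + chebT (mvar R n i) l).
    have h : (2^-1)%:MP * 2 = 1 :> {mpoly R[n]}.
      by rewrite -(mpolyC_nat n R 2) -mpolyCM mulVf ?mpolyC1 // pnatr_eq0.
    rewrite -[LHS]mul1r -[X in X * _ = _]h -mulrA; congr (_ * _).
    have := chebT_mul2 (mvar R n i) l.+1 1.
    rewrite chebT1 [_ * mvar _ _ _]mulrC => ->.
    by rewrite addn1 subn1 (_ : (1 - l.+1 = 0)%N) ?addn0.
  apply: cheb_spanZ; apply: cheb_spanD; apply: cheb_spanT; lia.
- rewrite -(mul0r 1) -(mpolyC0 n R) -(chebT0 (mvar R n i)).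
  exact/cheb_spanZ/cheb_spanT.
- exact: cheb_spanD.
Qed.

(** The expansion runs over the multi-indices with every entry at most [d], so
    that the index set is a product of intervals and sums over it of products
    over the variables factor. *)
Lemma mcheb_expansion (R : realType) n d (p : {mpoly R[n]}) : (tdeg p <= d)%N ->
  exists c : {ffun 'I_n -> 'I_d.+1} -> R,
    p = \sum_a (c a)%:MP * mcheb R n (fun i => a i).
Proof.
move=> degp; rewrite [p]mpolyE big_seq.
elim/big_ind: _ => [|p1 p2 [c1 ->] [c2 ->]|m mp].
- exists (fun=> 0); rewrite big1 // => a _.
  by rewrite mpolyC0 mul0r.
- exists (fun a => c1 a + c2 a); rewrite -big_split; apply: eq_bigr => a _.
  by rewrite mpolyCD mulrDl.
have md i : (m i <= d)%N.
  have := msize_mdeg_lt mp; rewrite tdeg_leE in degp => /leq_trans/(_ degp).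
  rewrite ltnS mdegE; apply: leq_trans.
  by rewrite (bigD1 i) //= leq_addr.
have H i := cheb_span_exp R i (md i).
pose b i := projT1 (cid (H i)).
have bE i : mvar R n i ^+ m i = \sum_j (b i j)%:MP * chebT (mvar R n i) j.
  exact: projT2 (cid (H i)).
exists (fun a => mcoeff m p * \prod_i b i (a i)).
rewrite mpolyXE_id -mul_mpolyC.
under [in LHS]eq_bigr => i _ do rewrite -/(mvar R n i) bE.
rewrite bigA_distr_bigA /= mulr_sumr; apply: eq_bigr => a _.
by rewrite big_split /= mpolyCM rmorph_prod mulrA.
Qed.

Definition cheb_grid (R : realType) (n N : nat) (g : {ffun 'I_n -> 'I_N}) :
  'I_n -> R := fun i => cheb_node R N (g i).
Arguments cheb_grid R {n N} g.

Lemma cheb_grid_box (R : realType) n N (g : {ffun 'I_n -> 'I_N}) :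
  box R n (cheb_grid R g).
Proof. by move=> i; apply: cheb_node_itv. Qed.

Lemma meval_mcheb (R : realType) n (a : 'I_n -> nat) (v : 'I_n -> R) :
  meval v (mcheb R n a) = \prod_i chebT (v i) (a i).
Proof.
rewrite rmorph_prod; apply: eq_bigr => i _.
by rewrite (proj1 (rmorph_cheb (meval v) _ _)) /= mevalXU.
Qed.

Lemma mcheb_orth (R : realType) n N (a b : 'I_n -> nat) :
  (forall i, (a i < N)%N) -> (forall i, (b i < N)%N) ->
  \sum_(g : {ffun 'I_n -> 'I_N})
    meval (cheb_grid R g) (mcheb R n a) * meval (cheb_grid R g) (mcheb R n b) =
  \prod_i (N%:R * ((a i == b i)%:R * (if b i == 0%N then 1 else 2^-1))).
Proof.
move=> aN bN; under [in RHS]eq_bigr => i _ do rewrite -cheb_node_orth //.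
rewrite bigA_distr_bigA; apply: eq_bigr => g _.
by rewrite !meval_mcheb -big_split.
Qed.

(** By orthogonality the coefficient of [mcheb b] is the mean of [p * mcheb b]
    over the grid, divided by the mean square of [mcheb b], which is at least
    [2^-n]. *)
Lemma mcheb_coeff_bound (R : realType) n d N (p : {mpoly R[n]}) (B : R)
    (c : {ffun 'I_n -> 'I_d.+1} -> R) :
  (d < N)%N -> p = \sum_a (c a)%:MP * mcheb R n (fun i => a i) ->
  (forall g : {ffun 'I_n -> 'I_N}, `|meval (cheb_grid R g) p| <= B) ->
  forall a, `|c a| <= 2 ^+ n * B.
Proof.
move=> dN pE pB b.
have aN (a : {ffun 'I_n -> 'I_d.+1}) i : (a i < N)%N by apply: leq_trans dN.
pose w := \prod_i (if b i == 0%N :> nat then 1 else 2^-1) : R.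
have E : \sum_(g : {ffun 'I_n -> 'I_N}) meval (cheb_grid R g) p *
    meval (cheb_grid R g) (mcheb R n (fun i => b i)) = N%:R ^+ n * (w * c b).
  transitivity (\sum_a c a * \sum_(g : {ffun 'I_n -> 'I_N})
      meval (cheb_grid R g) (mcheb R n (fun i => a i)) *
      meval (cheb_grid R g) (mcheb R n (fun i => b i))).
    under [RHS]eq_bigr => a _ do rewrite mulr_sumr.
    rewrite exchange_big; apply: eq_bigr => g _ /=.
    rewrite {1}pE rmorph_sum mulr_suml; apply: eq_bigr => a _.
    by rewrite rmorphM /= mevalC mulrA.
  rewrite (bigD1 b) //= [X in _ + X]big1 ?addr0 => [|a ab].
    rewrite mcheb_orth // big_split /= prodr_const card_ord mulrC -mulrA.
    congr (_ * _); congr (_ * _); apply: eq_bigr => i _.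
    by rewrite eqxx mul1r.
  rewrite mcheb_orth //.
  have [i abi] : exists i, a i != b i.
    by apply/existsP; apply: contraR ab; rewrite negb_exists => /forallP ab;
       apply/eqP/ffunP => i; apply/eqP; have := ab i; rewrite negbK.
  rewrite (bigD1 i) //= (_ : (a i == b i :> nat) = false); last exact: negbTE.
  by rewrite mul0r mulr0 mul0r mulr0.
have N0 : 0 < N%:R ^+ n :> R by rewrite exprn_gt0 // ltr0n; lia.
have w_ge : 2^-1 ^+ n <= w.
  rewrite -[X in _ ^+ X](card_ord n) -prodr_const; apply: ler_prod => i _.
  by rewrite invr_ge0 ler0n /=; case: ifP => // _; lra.
have w_gt0 : 0 < w by apply: lt_le_trans w_ge; rewrite exprn_gt0 // invr_gt0.
have : `|N%:R ^+ n * (w * c b)| <= N%:R ^+ n * B.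
  rewrite -E; apply: le_trans (ler_norm_sum _ _ _) _.
  have -> : N%:R ^+ n * B = \sum_(g : {ffun 'I_n -> 'I_N}) B.
    by rewrite sumr_const card_ffun !card_ord -[RHS]mulr_natl natrX.
  apply: ler_sum => g _; rewrite normrM -[B]mulr1.
  apply: ler_pM => //; rewrite meval_mcheb normr_prod.
  by apply: prodr_ile1 => i _; rewrite normr_ge0 chebT_le1 // cheb_node_itv.
rewrite !normrM (gtr0_norm N0) (gtr0_norm w_gt0) ler_pM2l // => wcB.
have : 2^-1 ^+ n * `|c b| <= B.
  by apply: le_trans wcB; rewrite ler_wpM2r.
rewrite -(@ler_pM2l _ (2 ^+ n)) ?exprn_gt0 // mulrA -exprMn.
by rewrite divff ?expr1n ?mul1r // pnatr_eq0.
Qed.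

(** * The averaging operator *)

(** The normalization makes the operator fix the constants. *)
Definition kernel_op (R : realType) (n N : nat) (p : {mpoly R[n]}) : {mpoly R[n]} :=
  ((N%:R * tent_corr R N 0)^-1 ^+ n)%:MP *
  \sum_(g : {ffun 'I_n -> 'I_N}) (meval (cheb_grid R g) p)%:MP *
    \prod_(i < n) tent_kernel N (mvar R n i) (cheb_node R N (g i))%:MP.

Lemma preordering_kernel_op (R : realType) n m (p : {mpoly R[n]}) :
  (forall x, box R n x -> 0 <= meval x p) ->
  preordering R n ((m.+1 + m.+1) * n) (kernel_op m.+2 p).
Proof.
move=> p0; apply: preorderingZ.
  by rewrite exprn_ge0 // invr_ge0 mulr_ge0 ?tent_corr_ge0.
apply: preordering_sum => g _; apply: preorderingZ.
  by apply: p0; apply: cheb_grid_box.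
by apply: preordering_prod => i; apply: preordering_tent_kernel; apply: cheb_node_itv.
Qed.

(** Sums over the grid of products over the coordinates factor, which reduces
    the claim to the univariate reproducing formula. *)
Lemma kernel_op_mcheb (R : realType) n d N (c : {ffun 'I_n -> 'I_d.+1} -> R) :
  (d < N)%N -> 0 < tent_corr R N 0 ->
  kernel_op N (\sum_a (c a)%:MP * mcheb R n (fun i => a i)) =
  \sum_a (c a * \prod_i (tent_corr R N (a i) / tent_corr R N 0))%:MP *
    mcheb R n (fun i => a i).
Proof.
move=> dN rho0; rewrite /kernel_op.
have N0 : N%:R != 0 :> R by rewrite pnatr_eq0; lia.
under eq_bigr => g _.
  rewrite (rmorph_sum (meval (cheb_grid R g))) (rmorph_sum (@mpolyC n R)) mulr_suml.
  under eq_bigr => a _ do rewrite rmorphM /= mevalC meval_mcheb mpolyCM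
    rmorph_prod -mulrA -big_split.
  over.
rewrite exchange_big mulr_sumr; apply: eq_bigr => a _ /=.
rewrite -mulr_sumr -(bigA_distr_bigA (fun i (j : 'I_N) =>
  (chebT (cheb_node R N j) (a i))%:MP *
  tent_kernel N (mvar R n i) (cheb_node R N j)%:MP)) /=.
under eq_bigr => i _.
  under eq_bigr => j _ do rewrite mulrC.
  rewrite (tent_kernel_reproducing (@mpolyC n R)); last first.
    by apply: leq_trans dN; apply: ltn_ord.
  over.
rewrite big_split /= -rmorph_prod mulrCA !mulrA -!mpolyCM; congr (_%:MP * _).
rewrite -mulrA; congr (_ * _).
rewrite -[X in _ ^+ X](card_ord n) -prodr_const -big_split.
by apply: eq_bigr => i _ /=; field; rewrite N0 lt0r_neq0.
Qed.

Lemma prod_1B_le (R : realType) n (l : 'I_n -> R) (e : R) :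
  (forall i, 0 <= l i <= 1) -> (forall i, 1 - l i <= e) ->
  0 <= 1 - \prod_i l i <= n%:R * e.
Proof.
move=> l01 le; have prod_le1 : \prod_i l i <= 1 by apply: prodr_ile1.
rewrite subr_ge0 prod_le1 /=.
elim: n l l01 le prod_le1 => [|n IH] l l01 le _.
  by rewrite big_ord0 mul0r subrr.
rewrite big_ord_recr /= -natr1 mulrDl mul1r.
set P := \prod_(i < n) _.
have l01' i : 0 <= l (widen_ord (leqnSn n) i) <= 1 by [].
have P1 : P <= 1 by apply: prodr_ile1.
have P0 : 0 <= P by apply: prodr_ge0 => i _; have /andP[] := l01' i.
have IHP := IH _ l01' (fun i => le _) P1; rewrite -/P in IHP.
have := le ord_max; have /andP[] := l01 ord_max; nra.
Qed.

(** The defect is at most [2 M l^2] and the square sum at least [M^3 / 3]. *)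
Lemma tent_corr_ratio (R : realType) M d l : (0 < M)%N -> (d < 2 * M)%N -> (l <= d)%N ->
  0 < tent_corr R (2 * M) 0 /\
  0 <= tent_corr R (2 * M) l / tent_corr R (2 * M) 0 <= 1 /\
  1 - tent_corr R (2 * M) l / tent_corr R (2 * M) 0 <= 6 * d%:R ^+ 2 / M%:R ^+ 2.
Proof.
move=> M0 dM ld.
have M0' : 0 < M%:R :> R by rewrite ltr0n.
have := tent_corr0_ge R M; rewrite natrX => rho_ge.
have rho0 : 0 < tent_corr R (2 * M) 0.
  by have := exprn_gt0 3 M0'; lra.
have /andP[rl rg] : tent_corr R (2 * M) l <= tent_corr R (2 * M) 0 <=
    tent_corr R (2 * M) l + (2 * M * l ^ 2)%:R by apply: tent_corr_gap; lia.
split=> //; split.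
  by rewrite divr_ge0 ?tent_corr_ge0 //= ler_pdivrMr // mul1r.
have gap : tent_corr R (2 * M) 0 - tent_corr R (2 * M) l <= 2 * M%:R * d%:R ^+ 2.
  have : (2 * M * l ^ 2)%:R <= 2 * M%:R * d%:R ^+ 2 :> R.
    by rewrite -natrX -!natrM ler_nat leq_mul2l leq_exp2r ?ld ?orbT.
  by lra.
rewrite -[X in X - _](divff (lt0r_neq0 rho0)) -mulrBl ler_pdivrMr //.
apply: le_trans gap _; rewrite [leRHS]mulrAC ler_pdivlMr ?exprn_gt0 //.
(* The defect [2 M d^2] times [M^2] is compared with [6 d^2] times [M^3 / 3]. *)
rewrite (_ : 2 * _ * _ * _ = 2 * d%:R ^+ 2 * M%:R ^+ 3); last by ring.
rewrite (_ : 6 * _ * _ = 2 * d%:R ^+ 2 * (3 * tent_corr R (2 * M) 0)); last by ring.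
by rewrite ler_wpM2l // mulr_ge0 // exprn_ge0.
Qed.

(** [(d+1)^n] multi-indices, coefficients at most [2^n B], and eigenvalues
    within [n * 6 d^2 / M^2] of one. *)
Definition kernel_constant (R : realType) (n d : nat) : R :=
  (d.+1 ^ n)%:R * (2 ^+ n * (n%:R * (6 * d%:R ^+ 2))).

Lemma preordering_perturb (R : realType) n d M r (p : {mpoly R[n]}) (B : R) :
  (tdeg p <= d)%N -> (forall x, box R n x -> 0 <= meval x p <= B) ->
  (0 < M)%N -> (d < 2 * M)%N ->
  ((2 * M).-1.*2 * n <= r)%N -> ((d + d) * n <= r)%N ->
  preordering R n r (p + (kernel_constant R n d * B / M%:R ^+ 2)%:MP).
Proof.
move=> degp p0B M0 dM Mr dr; have [c pE] := mcheb_expansion degp.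
have pos x : box R n x -> 0 <= meval x p by move=> /p0B /andP[].
pose lam k := tent_corr R (2 * M) k / tent_corr R (2 * M) 0.
have lam_bd k (kd : (k <= d)%N) := tent_corr_ratio R M0 dM kd.
have [rho0 _] := lam_bd 0%N isT.
have cB : forall a, `|c a| <= 2 ^+ n * B.
  apply: (mcheb_coeff_bound dM pE) => g.
  by have /andP[p_ge0 pB] := p0B _ (cheb_grid_box R g); rewrite ger0_norm.
pose q : R := n%:R * (6 * d%:R ^+ 2 / M%:R ^+ 2).
have gap (a : {ffun 'I_n -> 'I_d.+1}) : 0 <= 1 - \prod_i lam (a i) <= q.
  by apply: prod_1B_le => i; have [_ []] := lam_bd (a i) (leq_ord _).
have -> : p + (kernel_constant R n d * B / M%:R ^+ 2)%:MP =
    kernel_op (2 * M) p + \sum_(a : {ffun 'I_n -> 'I_d.+1})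
      ((2 ^+ n * B * q)%:MP +
       (c a * (1 - \prod_i lam (a i)))%:MP * mcheb R n (fun i => a i)).
  rewrite big_split /= addrCA addrC; congr (_ + _); last first.
    rewrite sumr_const card_ffun !card_ord -mpolyCMn; congr (_%:MP).
    by rewrite -[RHS]mulr_natl /kernel_constant /q; ring.
  rewrite [in kernel_op _ _]pE kernel_op_mcheb // -big_split [LHS]pE /=.
  apply: eq_bigr => a _; rewrite -mulrDl -mpolyCD; congr (_%:MP * _).
  by rewrite /lam; ring.
apply: preorderingD.
  apply: preordering_weaken Mr _; have -> : (2 * M = (2 * M).-2.+2)%N by lia.
  by rewrite -addnn; apply: preordering_kernel_op.
apply: preordering_sum => a _; apply: preordering_weaken dr _.
apply: preordering_mcheb => [i|]; first exact: leq_ord.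
have /andP[g0 gq] := gap a.
by rewrite normrM (ger0_norm g0); apply: ler_pM.
Qed.

(** * Existence of a rate constant *)

Lemma meval_bounded (R : realType) n (p : {mpoly R[n]}) :
  exists K : R, forall x, box R n x -> `|meval x p| <= K.
Proof.
exists (\sum_(m <- msupp p) `|mcoeff m p|) => x xbox; rewrite mevalE.
apply: le_trans (ler_norm_sum _ _ _) _; apply: ler_sum => m _.
rewrite normrM ler_piMr // normr_prod; apply: prodr_ile1 => i _.
by rewrite normr_ge0 normrX exprn_ile1 // ler_norml.
Qed.

Lemma box_min_le_max (R : realType) n (p : {mpoly R[n]}) x :
  box R n x -> box_min p <= meval x p <= box_max p.
Proof.
move=> xbox; have [K HK] := meval_bounded p.
have px : [set meval x p | x in box R n] (meval x p) by exists x.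
apply/andP; split.
  apply: ge_inf => //; exists (- K) => _ [y ybox <-].
  by have := HK y ybox; rewrite ler_norml => /andP[].
apply: ub_le_sup => //; exists K => _ [y ybox <-].
by have := HK y ybox; rewrite ler_norml => /andP[].
Qed.

Lemma box0 (R : realType) n : box R n (fun=> 0).
Proof. by move=> i; apply/andP; split; lra. Qed.

Lemma box_min_ge0 (R : realType) n (p : {mpoly R[n]}) :
  (forall x, box R n x -> 0 <= meval x p) -> 0 <= box_min p.
Proof.
move=> p0; apply: lb_le_inf => [|_ [x xbox <-]]; last exact: p0.
by exists (meval (fun=> 0) p); exists (fun=> 0) => //; apply: box0.
Qed.

(** The threshold exceeds [2 d] when [d > 0], since [pi >= 2] and [2 n > 1]. *)
Lemma degree_lt_half (R : realType) n d r : (1 <= n)%N -> (1 <= r)%N ->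
  @pi R * d%:R * Num.sqrt (2 * n%:R) <= r%:R -> (2 * d < r)%N.
Proof.
move=> n1 r1 rd; case: d rd => [//|d] rd.
have n1' : 1 <= n%:R :> R by rewrite ler1n.
have s1 : 1 < Num.sqrt (2 * n%:R) :> R.
  rewrite -[X in X < _](sqrtr1 R) ltr_sqrt; first by lra.
  by rewrite mulr_gt0 // ltr0n.
rewrite -(ltr_nat R) natrM; apply: lt_le_trans rd.
have d0 : 0 < d.+1%:R :> R by rewrite ltr0n.
apply: (@le_lt_trans _ _ (pi * d.+1%:R)).
  by rewrite ler_wpM2r ?pi_ge2 // ltW.
by rewrite ltr_pMr // mulr_gt0 ?pi_gt0.
Qed.

Lemma exists_rate_constant (R : realType) n d : (1 <= n)%N ->
  exists C : R, 0 < C /\ rate_constant n d C.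
Proof.
move=> n1; have K0 : 0 <= kernel_constant R n d.
  by rewrite !mulr_ge0 // ?exprn_ge0.
exists (16 * kernel_constant R n d + 1); split; first by lra.
move=> h r dh r1 rd; have d2r := degree_lt_half n1 r1 rd.
set B := box_max h - box_min h; set p := h - (box_min h)%:MP.
have hbd x : box R n x -> box_min h <= meval x h <= box_max h.
  exact: box_min_le_max.
have pB x : box R n x -> 0 <= meval x p <= B.
  by move=> /hbd; rewrite /p mevalB mevalC /B; lra.
have B0 : 0 <= B by have := pB _ (@box0 R n); lra.
(* The kernel with [N = 2 M] has degree [2 (2 M - 1)] in each variable, which
   must not exceed [r + 1]. *)
pose M := ((r + 3) %/ 4)%N.
have M0 : (0 < M)%N by rewrite /M; lia.
have rM : (r <= 4 * M)%N by rewrite /M; lia.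
have Mr : (4 * M <= r + 3)%N by rewrite /M; lia.
pose e := kernel_constant R n d * B / M%:R ^+ 2.
have Qp : preordering R n (r.+1 * n) (p + e%:MP).
  apply: (@preordering_perturb _ _ d) => //; last 3 first.
  - by lia.
  - by rewrite leq_mul2r; apply/orP; right; lia.
  - by rewrite leq_mul2r; apply/orP; right; lia.
  by apply: tdegD_le; rewrite ?dh // tdegN tdegC.
have lb : ((box_min h - e)%:E <= lower_bound (r.+1 * n) h)%E.
  apply: ereal_sup_ubound; exists (box_min h - e) => //=.
  by rewrite (_ : h - _ = p + e%:MP) // mpolyCB /p; ring.
have e_le : e <= (16 * kernel_constant R n d + 1) / r%:R ^+ 2 * B.
  have r0 : 0 < r%:R :> R by rewrite ltr0n.
  have M0' : 0 < M%:R :> R by rewrite ltr0n.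
  have rM' : r%:R <= 4 * M%:R :> R by rewrite -natrM ler_nat.
  have h1 : r%:R ^+ 2 <= 16 * M%:R ^+ 2 :> R by nra.
  have KB : 0 <= kernel_constant R n d * B by rewrite mulr_ge0.
  rewrite /e [leRHS]mulrAC ler_pdivrMr ?exprn_gt0 //.
  rewrite [leRHS]mulrAC ler_pdivlMr ?exprn_gt0 //.
  have M2 : 0 <= M%:R ^+ 2 :> R by rewrite exprn_ge0.
  have h2 := ler_wpM2l KB h1; nra.
apply: (@le_trans _ _ ((box_min h)%:E - (box_min h - e)%:E)%E).
  by rewrite leeB.
by rewrite -EFinB lee_fin opprB addrCA subrr addr0.
Qed.

(** * Sums of squares with few terms *)

(** A planar rotation of a pair [(v, q)] preserves [v^2 + q^2] and can be chosen
    to make the coefficient of [m] in the second polynomial vanish; iterating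
    along the list gathers all of that coefficient in a single polynomial [v].
    The last clause says that no new monomial appears, so that monomials can be
    treated one after another. *)
Lemma sos_rotate (R : realType) n (s : seq {mpoly R[n]}) (m : multinom n) :
  exists v s', [/\ \sum_(q <- s) q ^+ 2 = v ^+ 2 + \sum_(q <- s') q ^+ 2,
    forall q, q \in s' -> mcoeff m q = 0 &
    forall k, (forall q, q \in s -> mcoeff k q = 0) ->
      mcoeff k v = 0 /\ forall q, q \in s' -> mcoeff k q = 0].
Proof.
elim: s => [|q s [v [s' [sE s'm s'k]]]].
  exists 0, [::]; split=> //; first by rewrite big_nil expr0n addr0.
  by move=> k _; rewrite mcoeff0.
set a := mcoeff m v; set b := mcoeff m q.
have [b0|b0] := eqVneq b 0.
  exists v, (q :: s'); split=> [|q'|k qs].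
  - by rewrite !big_cons sE; ring.
  - by rewrite inE => /orP[/eqP->//|/s'm].
  - have [|vk sk] := s'k k; first by move=> q' q's; apply: qs; rewrite inE q's orbT.
    split=> // q'; rewrite inE => /orP[/eqP->|/sk//].
    by apply: qs; rewrite inE eqxx.
(* The angle of the rotation has cosine [a / rho] and sine [b / rho]. *)
pose rho := Num.sqrt (a ^+ 2 + b ^+ 2).
have ab0 : 0 < a ^+ 2 + b ^+ 2.
  by rewrite ltr_wpDl ?sqr_ge0 // exprn_even_gt0.
have rho0 : rho != 0 by rewrite lt0r_neq0 // sqrtr_gt0.
pose c := a / rho; pose d := b / rho.
have cd1 : c ^+ 2 + d ^+ 2 = 1.
  rewrite !expr_div_n -mulrDl sqr_sqrtr ?ltW // divff //; exact: lt0r_neq0.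
have CD1 : c%:MP ^+ 2 + d%:MP ^+ 2 = 1 :> {mpoly R[n]}.
  by rewrite -!rmorphXn -mpolyCD cd1 mpolyC1.
exists (c%:MP * v + d%:MP * q), ((c%:MP * q - d%:MP * v) :: s'); split.
- rewrite !big_cons sE addrA -[X in X + _ = _]addrC -[v ^+ 2 + _]mul1r -CD1.
  by ring.
- move=> q'; rewrite inE => /orP[/eqP->|/s'm//].
  by rewrite mcoeffB !mcoeffCM -/a -/b /c /d; ring.
- move=> k qs; have [|vk sk] := s'k k.
    by move=> q' q's; apply: qs; rewrite inE q's orbT.
  have qk : mcoeff k q = 0 by apply: qs; rewrite inE eqxx.
  split; first by rewrite mcoeffD !mcoeffCM vk qk !mulr0 addr0.
  move=> q'; rewrite inE => /orP[/eqP->|/sk//].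
  by rewrite mcoeffB !mcoeffCM vk qk !mulr0 subr0.
Qed.

Lemma sos_shorten (R : realType) n (ms : seq (multinom n)) (s : seq {mpoly R[n]}) :
  (forall q, q \in s -> forall m, m \notin ms -> mcoeff m q = 0) ->
  exists t, [/\ size t = size ms, \sum_(q <- s) q ^+ 2 = \sum_(q <- t) q ^+ 2 &
    forall q, q \in t -> forall m, m \notin ms -> mcoeff m q = 0].
Proof.
elim: ms s => [|m ms IH] s sms.
  exists [::]; split=> //; rewrite big_nil big_seq big1 // => q qs.
  have -> : q = 0 by apply/mpolyP => m; rewrite mcoeff0 (sms q qs).
  by rewrite expr0n.
have [v [s' [sE s'm s'k]]] := sos_rotate s m.
have out k : k \notin m :: ms -> mcoeff k v = 0 /\ forall q, q \in s' -> mcoeff k q = 0.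
  by move=> kms; apply: s'k => q qs; apply: sms.
have [|t [tms tE tout]] := IH s'.
  move=> q qs k kms; have [->|km] := eqVneq k m; first exact: s'm.
  by have [|_ ->] := out k; rewrite // inE (negbTE km).
exists (v :: t); split; first by rewrite /= tms.
  by rewrite big_cons sE tE.
move=> q; rewrite inE => /orP[/eqP->|qt] k kms; first by have [] := out k kms.
by apply: tout => //; move: kms; rewrite inE negb_or => /andP[].
Qed.

(** Leading terms of squares cannot cancel: at twice the largest leading
    monomial [m], the coefficient of the sum is the sum of the squares of the
    coefficients of [m]. *)
Lemma tdeg_sos_summand (R : realType) n (s : seq {mpoly R[n]}) k :
  (tdeg (\sum_(q <- s) q ^+ 2)%R <= k)%N -> forall q, q \in s -> (tdeg q <= k)%N.
Proof.
move=> degs q0 q0s.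
have [q1 q1s q1max] : exists2 q1, q1 \in s &
    forall q, q \in s -> (mlead q <= mlead q1)%O.
  elim: s {degs} q0 q0s => [//|q s IH] q0 _.
  case: s IH => [_|q' s IH].
    by exists q; rewrite ?inE // => r; rewrite inE => /eqP->.
  have [|q1 q1s q1max] := IH q'; first by rewrite inE eqxx.
  have [le|/ltW le] := leP (mlead q) (mlead q1).
    exists q1; first by rewrite inE q1s orbT.
    by move=> r; rewrite inE => /orP[/eqP->//|/q1max].
  exists q; first by rewrite inE eqxx.
  by move=> r; rewrite inE => /orP[/eqP->//|/q1max/le_trans]; apply.
have [q1z|q1z] := eqVneq q1 0.
  have := lemc_mdeg (q1max _ q0s); rewrite q1z mlead0 mdeg0 leqn0 => /eqP lead0.
  have [->|q0z] := eqVneq q0 0; first by rewrite -(mpolyC0 n R) tdegC.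
  by rewrite tdeg_leE -(mlead_deg q0z) lead0.
set m := mlead q1 in q1max.
have coefE : mcoeff (mnm_add m m) (\sum_(q <- s) q ^+ 2) =
    \sum_(q <- s) mcoeff m q ^+ 2.
  rewrite raddf_sum /= big_seq [RHS]big_seq; apply: eq_bigr => q qs.
  by rewrite expr2 mleadcMW ?q1max.
have pos : 0 < \sum_(q <- s) mcoeff m q ^+ 2.
  rewrite (big_rem q1) //= ltr_wpDr ?sumr_ge0 // => [q _|]; first exact: sqr_ge0.
  by rewrite exprn_even_gt0 //= mleadc_eq0.
have : (mnm_add m m) \in msupp (\sum_(q <- s) q ^+ 2).
  by rewrite mcoeff_msupp coefE lt0r_neq0.
move/msize_mdeg_lt; rewrite tdeg_leE in degs; move=> /leq_trans/(_ degs).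
rewrite mdegD ltnS => mk.
rewrite tdeg_leE; have [->|q0z] := eqVneq q0 0; first by rewrite mmeasure0.
rewrite -(mlead_deg q0z) ltnS.
apply: leq_trans (lemc_mdeg (q1max _ q0s)) _.
by apply: leq_trans mk; apply: leq_addr.
Qed.

(** * Control of polynomials through the nodes, and continuity of coefficients *)

(** A coefficient is a linear form of the Chebyshev coefficients, hence of the
    values on the grid. *)
Lemma coeff_bound_grid (R : realType) n r (m : multinom n) :
  exists K : R, forall (p : {mpoly R[n]}) (B : R), (tdeg p <= r)%N ->
    (forall g : {ffun 'I_n -> 'I_r.+1}, `|meval (cheb_grid R g) p| <= B) ->
    `|mcoeff m p| <= K * B.
Proof.
exists (\sum_(a : {ffun 'I_n -> 'I_r.+1})
  2 ^+ n * `|mcoeff m (mcheb R n (fun i => a i))|) => p B degp pB.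
have [c pE] := mcheb_expansion degp.
have cB := mcheb_coeff_bound (ltnSn r) pE pB.
rewrite pE raddf_sum mulr_suml /=; apply: le_trans (ler_norm_sum _ _ _) _.
apply: ler_sum => a _; rewrite mcoeffCM normrM mulrAC.
by rewrite ler_wpM2r.
Qed.

Lemma meval_sos_ge0 (R : realType) n (v : 'I_n -> R) (p : {mpoly R[n]}) :
  is_sos p -> 0 <= meval v p.
Proof.
move=> [s ->]; rewrite rmorph_sum sumr_ge0 // => q _.
by rewrite rmorphXn sqr_ge0.
Qed.

Lemma meval_box_g (R : realType) n (v : 'I_n -> R) i :
  meval v (box_g R i) = 1 - v i ^+ 2.
Proof. by rewrite rmorphB rmorph1 rmorphXn /= mevalXU. Qed.

Lemma meval_box_gJ_ge0 (R : realType) n (v : 'I_n -> R) J :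
  box R n v -> 0 <= meval v (box_gJ R J).
Proof.
move=> vbox; rewrite rmorph_prod prodr_ge0 // => i _.
by rewrite /= meval_box_g; have := vbox i; nra.
Qed.

Lemma meval_box_gJ_grid (R : realType) n N (g : {ffun 'I_n -> 'I_N}) J :
  0 < meval (cheb_grid R g) (box_gJ R J).
Proof.
rewrite rmorph_prod prodr_gt0 // => i _.
by rewrite /= meval_box_g; apply: cheb_node_lt1.
Qed.

Lemma preordering_ge0 (R : realType) n r (p : {mpoly R[n]}) v :
  preordering R n r p -> box R n v -> 0 <= meval v p.
Proof.
move=> [s [Hs ->]] vbox; rewrite rmorph_sum sumr_ge0 // => J _.
have [sJ _] := Hs J.
by rewrite rmorphM; apply: mulr_ge0; [exact: meval_sos_ge0|exact: meval_box_gJ_ge0].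
Qed.

Lemma continuous_sum (R : realType) (T : topologicalType) (I : Type) (s : seq I)
    (Q : pred I) (F : I -> T -> R) :
  (forall i, continuous (F i)) -> continuous (fun t => \sum_(i <- s | Q i) F i t).
Proof. by move=> H; apply: continuous_big => //; apply: add_continuous. Qed.

(** Continuity into the space of polynomials, coefficientwise, so that no
    topology on that space is needed. *)
Definition coeff_continuous (R : realType) n (T : topologicalType)
    (P : T -> {mpoly R[n]}) :=
  forall m, continuous (fun t => mcoeff m (P t) : R).

Lemma coeff_continuous_sum (R : realType) n (T : topologicalType) (I : Type)
    (s : seq I) (Q : pred I) (P : I -> T -> {mpoly R[n]}) :
  (forall i, coeff_continuous (P i)) ->
  coeff_continuous (fun t => \sum_(i <- s | Q i) P i t).
Proof.
move=> H m; rewrite (_ : (fun t => _) =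
  (fun t => \sum_(i <- s | Q i) mcoeff m (P i t))); last first.
  by apply: funext => t; rewrite raddf_sum.
by apply: continuous_sum => i; apply: H.
Qed.

Lemma coeff_continuousM (R : realType) n (T : topologicalType)
    (P Q : T -> {mpoly R[n]}) :
  coeff_continuous P -> coeff_continuous Q ->
  coeff_continuous (fun t => P t * Q t).
Proof.
move=> cP cQ m.
under [X in continuous X]funext => t do rewrite mcoeffM.
by apply: continuous_sum => k t; apply: cvgM; [apply: cP|apply: cQ].
Qed.

Lemma coeff_continuous_cst (R : realType) n (T : topologicalType)
    (p : {mpoly R[n]}) : coeff_continuous (fun _ : T => p).
Proof. by move=> m t; apply: cvg_cst. Qed.

Lemma coeff_continuousC (R : realType) n (T : topologicalType) (c : T -> R) :
  continuous c -> coeff_continuous (fun t => (c t)%:MP : {mpoly R[n]}).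
Proof.
move=> cc m; under [X in continuous X]funext => t do rewrite mcoeffC.
by move=> t; apply: cvgM; [apply: cc|apply: cvg_cst].
Qed.

(** * Parametrization of certificates *)

Lemma tdeg_leP (R : realType) n (p : {mpoly R[n]}) r :
  (tdeg p <= r)%N <-> forall m, (r < mdeg m)%N -> mcoeff m p = 0.
Proof.
rewrite tdeg_leE; split=> [degp m rm|H].
  apply/eqP; rewrite mcoeff_eq0; apply: msize_mdeg_ge.
  exact: leq_trans rm.
rewrite mmeasureE big_seq; elim/big_ind: _ => [//|a b|m mp].
  by rewrite geq_max => -> ->.
rewrite ltnS leqNgt; apply: contraL mp => /H pm.
by rewrite mcoeff_msupp pm eqxx.
Qed.

Definition bounded_monomials (n r : nat) : seq (multinom n) :=
  [seq (m : multinom n) | m : bmultinom n r.+1].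

Lemma mem_bounded_monomials n r m :
  (m \in bounded_monomials n r) = (mdeg m <= r)%N.
Proof.
apply/fintype.imageP/idP => [[k _ ->]|mr]; first by rewrite -ltnS bmdeg.
by exists (BMultinom (mr : (mdeg m < r.+1)%N)).
Qed.

Definition sos_index (n r : nat) : eqType :=
  ({set 'I_n} * 'I_(size (bounded_monomials n r)) * bmultinom n r.+1)%type.

(** A point lists, for every set [J] of constraints, the coefficients of as many
    polynomials of degree at most [r] as there are monomials of degree at most
    [r].  Bounded sets of this product are relatively compact by the Tychonoff
    theorem. *)
Definition sos_params (R : realType) (n r : nat) : topologicalType :=
  prod_topology (fun _ : sos_index n r => R : topologicalType).

Definition param_summand (R : realType) n r (c : sos_params R n r)
    (J : {set 'I_n}) (i : 'I_(size (bounded_monomials n r))) : {mpoly R[n]} :=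
  \sum_(m : bmultinom n r.+1) (c (J, i, m))%:MP * mpolyX R m.

Definition param_sos (R : realType) n r (c : sos_params R n r)
    (J : {set 'I_n}) : {mpoly R[n]} := \sum_i param_summand c J i ^+ 2.

Definition param_preordering (R : realType) n r (c : sos_params R n r) :
  {mpoly R[n]} := \sum_J param_sos c J * box_gJ R J.

(** The summands of the multiplier of [J] have degree at most [r], since neither
    the product with the nonzero [box_gJ R J] nor the sum of squares can lower
    the degree; their number is then reduced by rotations. *)
Lemma sos_params_complete (R : realType) n r (s : {set 'I_n} -> {mpoly R[n]}) :
  (forall J, is_sos (s J) /\ (tdeg (s J * box_gJ R J)%R <= r)%N) ->
  exists c : sos_params R n r,
    (forall J i, (tdeg (param_summand c J i) <= r)%N) /\ forall J, param_sos c J = s J.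
Proof.
move=> Hs.
have H J : exists q : 'I_(size (bounded_monomials n r)) -> {mpoly R[n]},
    (forall i, (tdeg (q i) <= r)%N) /\ s J = \sum_i q i ^+ 2.
  have [[t sE] degs] := Hs J.
  have gJ0 : box_gJ R J != 0.
    have := @meval_box_gJ_grid R n 1 [ffun=> ord0] J.
    by apply: contraTneq => ->; rewrite meval0 ltxx.
  have degsJ : (tdeg (s J) <= r)%N.
    have [->|s0] := eqVneq (s J) 0; first by rewrite -(mpolyC0 n R) tdegC.
    move: degs; rewrite !tdeg_leE msizeM //.
    have : mmeasure mdeg (box_gJ R J) != 0%N by rewrite mmeasure_poly_eq0.
    by move: (mmeasure _ (s J)) (mmeasure _ (box_gJ R J)) => a b; lia.
  rewrite sE in degsJ; have degt := tdeg_sos_summand degsJ.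
  have [u [uL uE uout]] : exists u, [/\ size u = size (bounded_monomials n r),
      \sum_(q <- t) q ^+ 2 = \sum_(q <- u) q ^+ 2 &
      forall q, q \in u -> forall m, m \notin bounded_monomials n r -> mcoeff m q = 0].
    apply: sos_shorten => q qt m; rewrite mem_bounded_monomials -ltnNge => rm.
    by have /tdeg_leP := degt q qt; apply.
  exists (fun i => nth 0 u i); split=> [i|].
    apply/tdeg_leP => m rm; have [iu|ui] := ltnP i (size u).
      by apply: (uout _ (mem_nth 0 iu)); rewrite mem_bounded_monomials -ltnNge.
    by rewrite nth_default ?mcoeff0.
  by rewrite sE uE (big_nth 0) big_mkord uL.
pose q J := projT1 (cid (H J)).
have qP J : (forall i, (tdeg (q J i) <= r)%N) /\ s J = \sum_i q J i ^+ 2.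
  exact: projT2 (cid (H J)).
pose c : sos_params R n r := fun k => mcoeff k.2 (q k.1.1 k.1.2).
have cE J i : param_summand c J i = q J i.
  have [degq _] := qP J; rewrite [RHS](@mpolywE _ _ r.+1) -?tdeg_leE //.
  by apply: eq_bigr => m _; rewrite mul_mpolyC.
exists c; split=> [J i|J]; have [degq sJ] := qP J; first by rewrite cE.
by rewrite sJ; apply: eq_bigr => i _; rewrite cE.
Qed.

(** * Attainment of the lower bound *)

Lemma coeff_continuous_summand (R : realType) n r J i :
  coeff_continuous (fun c : sos_params R n r => param_summand c J i).
Proof.
apply: coeff_continuous_sum => m; apply: coeff_continuousM.
  by apply: coeff_continuousC; apply: proj_continuous.
exact: coeff_continuous_cst.
Qed.

Lemma coeff_continuous_sosM (R : realType) n r J :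
  coeff_continuous (fun c : sos_params R n r => param_sos c J * box_gJ R J).
Proof.
apply: coeff_continuousM; last exact: coeff_continuous_cst.
apply: coeff_continuous_sum => i.
by apply: coeff_continuousM; apply: coeff_continuous_summand.
Qed.

Lemma coeff_continuous_preordering (R : realType) n r :
  coeff_continuous (@param_preordering R n r).
Proof. by apply: coeff_continuous_sum => J; apply: coeff_continuous_sosM. Qed.

Lemma param_summand_coeff (R : realType) n r (c : sos_params R n r) J i
    (m : bmultinom n r.+1) : mcoeff m (param_summand c J i) = c (J, i, m).
Proof.
rewrite raddf_sum (bigD1 m) //= mcoeffCM mcoeffX eqxx mulr1 big1 ?addr0 //.
move=> k km; rewrite mcoeffCM mcoeffX.
by rewrite (_ : (_ == _) = false) ?mulr0 //; apply/negbTE; rewrite -bmeqP.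
Qed.

(** At a node every term of the certificate is nonnegative and [box_gJ R J] is
    positive, so a single squared summand is at most [B] divided by the latter;
    [|a| <= 1 + a^2] avoids the square root. *)
Lemma param_summand_bound (R : realType) n r (c : sos_params R n r)
    (p : {mpoly R[n]}) (B : R) J i (g : {ffun 'I_n -> 'I_r.+1}) :
  p = param_preordering c -> meval (cheb_grid R g) p <= B ->
  `|meval (cheb_grid R g) (param_summand c J i)| <=
    1 + B / meval (cheb_grid R g) (box_gJ R J).
Proof.
move=> pE pB; set v := cheb_grid R g; set q := param_summand c J i.
have gJ0 : 0 < meval v (box_gJ R J) := meval_box_gJ_grid R g J.
have q2 : meval v q ^+ 2 <= B / meval v (box_gJ R J).
  have evE : meval v p = \sum_K meval v (param_sos c K) * meval v (box_gJ R K).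
    by rewrite pE rmorph_sum; apply: eq_bigr => K _; rewrite rmorphM.
  have sosE K : meval v (param_sos c K) = \sum_k meval v (param_summand c K k) ^+ 2.
    by rewrite rmorph_sum; apply: eq_bigr => k _; rewrite rmorphXn.
  have sos0 K : 0 <= meval v (param_sos c K).
    by rewrite sosE sumr_ge0 // => k _; apply: sqr_ge0.
  rewrite ler_pdivlMr //; apply: le_trans pB; rewrite -/v evE (bigD1 J) //=.
  rewrite -[leLHS]addr0 lerD ?sumr_ge0 // => [|K _]; last first.
    by rewrite mulr_ge0 // meval_box_gJ_ge0 //; apply: cheb_grid_box.
  rewrite ler_wpM2r ?(ltW gJ0) // sosE (bigD1 i) //= lerDl sumr_ge0 // => k _.
  exact: sqr_ge0.
apply: le_trans (lerD (lexx 1) q2); rewrite -[X in 1 + X]real_normK ?num_real //.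
have := normr_ge0 (meval v q); set a := `|_|; nra.
Qed.

(** The certificates of all feasible [l >= l0] lie in a cube given by the node
    bounds.  Being a certificate for some [l] is a closed condition on
    parameters: the nonconstant coefficients are prescribed and those of degree
    above [r] vanish.  On this compact set [l] is a continuous function, namely
    the difference of the constant coefficients. *)
Lemma preordering_max_attained (R : realType) n r (f : {mpoly R[n]}) :
  (exists l, preordering R n r (f - l%:MP)) ->
  exists l, preordering R n r (f - l%:MP) /\
    forall l', preordering R n r (f - l'%:MP) -> l' <= l.
Proof.
move=> [l0 feas0].
pose lam (c : sos_params R n r) := mcoeff mnm0 f - mcoeff mnm0 (param_preordering c).
(* [D J] bounds the values at the nodes of every summand for [J], whatever the
   feasible [l >= l0]; [b] turns this into bounds on coefficients. *)
pose D J := 1 + \sum_(g : {ffun 'I_n -> 'I_r.+1})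
   (box_max f - l0) / meval (cheb_grid R g) (box_gJ R J).
pose b (k : sos_index n r) : R :=
  projT1 (cid (coeff_bound_grid R r (k.2 : multinom n))) * D k.1.1.
pose cube : set (sos_params R n r) :=
  [set c | forall k, `[- b k, b k]%classic (c k)].
have cube_compact : compact cube.
  apply: (@tychonoff (sos_index n r) (fun=> R) (fun k => `[- b k, b k]%classic)).
  by move=> k; apply: segment_compact.
pose Z := cube `&`
  ((\bigcap_(m in [set m | m != mnm0])
     [set c | mcoeff m (param_preordering c) = mcoeff m f])
   `&` (\bigcap_(Jm in [set Jm | (r < mdeg Jm.2)%N])
     [set c | mcoeff Jm.2 (param_sos c Jm.1 * box_gJ R Jm.1) = 0])).
have Zcompact : compact Z.
  apply: compact_closedI cube_compact _; apply: closedI; apply: closed_bigI => x _.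
    apply: (@preimage_closed _ _ (fun c => mcoeff x (param_preordering c))
      [set y | y = mcoeff x f]); last exact: closed_eq.
    by move=> c _; apply: coeff_continuous_preordering.
  apply: (@preimage_closed _ _ (fun c => mcoeff x.2 (param_sos c x.1 * box_gJ R x.1))
      [set y | y = 0]); last exact: closed_eq.
  by move=> c _; apply: coeff_continuous_sosM.
have Zfeas c : Z c -> preordering R n r (f - (lam c)%:MP).
  move=> [_ [Z1 Z2]]; exists (param_sos c); split=> [J|].
    split; last by apply/tdeg_leP => m rm; apply: (Z2 (J, m)).
    exists [seq param_summand c J i | i <- index_enum _].
    by rewrite big_map.
  apply/mpolyP => m; rewrite mcoeffB mcoeffC -/(param_preordering c).
  have [->|m0] := eqVneq m mnm0; first by rewrite mulr1 /lam; ring.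
  by rewrite mulr0 subr0 (Z1 m m0).
have feasZ l : l0 <= l -> preordering R n r (f - l%:MP) ->
    exists2 c, Z c & lam c = l.
  move=> l0l [s [Hs sE]]; have [c [degc cs]] := sos_params_complete Hs.
  have pE : f - l%:MP = param_preordering c.
    by rewrite sE; apply: eq_bigr => J _; rewrite cs.
  exists c; last by rewrite /lam -pE mcoeffB mcoeffC eqxx mulr1; ring.
  split=> [[[J i] m]|].
    have B0 g : 0 <= (box_max f - l0) / meval (cheb_grid R g) (box_gJ R J).
      rewrite divr_ge0 ?(ltW (meval_box_gJ_grid _ _ _)) //.
      have /andP[_] := box_min_le_max f (cheb_grid_box R g).
      have := preordering_ge0 feas0 (cheb_grid_box R g).
      by rewrite mevalB mevalC; lra.
    rewrite /= in_itv /= -ler_norml -param_summand_coeff.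
    apply: (projT2 (cid (coeff_bound_grid R r m))) => // g.
    apply: le_trans (param_summand_bound (B := box_max f - l0) J i pE _) _.
      have /andP[_] := box_min_le_max f (cheb_grid_box R g).
      by rewrite mevalB mevalC; lra.
    by rewrite /D lerD2l (bigD1 g) //= lerDl sumr_ge0.
  split=> [m m0|[J m] rm] /=.
    by rewrite -pE mcoeffB mcoeffC (negbTE m0) mulr0 subr0.
  by rewrite cs; have [_ /tdeg_leP->] := Hs J.
have [c0 Zc0 _] := feasZ l0 (lexx _) feas0.
have [|c Zc cmin] := compact_EVT_min (ex_intro _ c0 Zc0) Zcompact
    (f := fun c => mcoeff mnm0 (param_preordering c)).
  exact/continuous_subspaceT/coeff_continuous_preordering.
have cmax c' : Z c' -> lam c' <= lam c.
  by move=> Zc'; rewrite /lam lerD2l lerN2 cmin // inE.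
rewrite inE in Zc; exists (lam c); split=> [|l feas]; first exact: Zfeas.
have [l0l|ll0] := leP l0 l.
  by have [c' Zc' <-] := feasZ l l0l feas; apply: cmax.
have [c' Zc' c'l0] := feasZ l0 (lexx _) feas0.
by apply: le_trans (ltW ll0) _; rewrite -c'l0; apply: cmax.
Qed.

(** * Consequences of a rate constant *)

(** If no feasible value reached [mu], the maximum of the feasible values would
    be a smaller upper bound. *)
Lemma preordering_of_lower_bound (R : realType) n r (f : {mpoly R[n]}) (mu : R) :
  (mu%:E <= lower_bound r f)%E -> preordering R n r (f - mu%:MP).
Proof.
move=> mu_le.
(* Some value is feasible, because the supremum of the empty set is [-oo]. *)
have [l feas lmax] : exists2 l, preordering R n r (f - l%:MP) &
    forall l', preordering R n r (f - l'%:MP) -> l' <= l.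
  have [feas|infeas] := pselect (exists l, preordering R n r (f - l%:MP)).
    by have [l [? ?]] := preordering_max_attained feas; exists l.
  move: mu_le; rewrite /lower_bound (_ : [set _ | _ in _] = set0) ?ereal_sup0 //.
  by apply/seteqP; split=> // x [l feas xE]; apply: infeas; exists l.
have mul : mu <= l.
  rewrite -lee_fin; apply: le_trans mu_le _; apply: ge_ereal_sup => _ [l' feas' <-].
  by rewrite lee_fin; apply: lmax.
have -> : f - mu%:MP = (f - l%:MP) + (l - mu)%:MP by rewrite mpolyCB; ring.
by apply: preorderingD => //; apply: preorderingC; rewrite subr_ge0.
Qed.

Lemma preordering_const (R : realType) n r (f : {mpoly R[n]}) :
  tdeg f = 0%N -> (forall x, box R n x -> 0 <= meval x f) ->
  preordering R n r f.
Proof.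
move=> degf f0; have fC : f = (mcoeff mnm0 f)%:MP.
  by apply: msize1_polyC; rewrite -tdeg_leE degf.
rewrite fC; apply: preorderingC.
by have := f0 _ (@box0 R n); rewrite {1}fC mevalC.
Qed.

(** For [d = 0] the integer [r] may be zero, where the rate says nothing; the
    polynomial is then a nonnegative constant. *)
Lemma preordering_of_rate (R : realType) n d (C : R) (f : {mpoly R[n]}) (eta : R) r :
  (1 <= n)%N -> 0 < C -> rate_constant n d C -> tdeg f = d ->
  (forall x, box R n x -> 0 <= meval x f) -> 0 < eta ->
  Num.max (@pi R * d%:R * Num.sqrt (2 * n%:R))
          ((Num.sqrt eta)^-1 * Num.sqrt (C * (box_max f - box_min f))) <= r%:R ->
  preordering R n (r.+1 * n) (f + eta%:MP).
Proof.
move=> n1 C0 rate degf f0 eta0; rewrite ge_max => /andP[rd rC].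
have [d0|d0] := eqVneq d 0%N.
  apply: preorderingD; last by apply: preorderingC; apply: ltW.
  by apply: preordering_const => //; rewrite degf.
have r1 : (1 <= r)%N.
  rewrite -(ltr0n R); apply: lt_le_trans rd.
  by rewrite !mulr_gt0 ?pi_gt0 ?ltr0n ?lt0n // sqrtr_gt0 mulr_gt0 // ltr0n.
set B := box_max f - box_min f in rC.
have B0 : 0 <= B.
  by have := box_min_le_max f (@box0 R n); rewrite /B; lra.
have r0 : 0 < r%:R :> R by rewrite ltr0n.
have e_le : C / r%:R ^+ 2 * B <= eta.
  rewrite mulrAC ler_pdivrMr ?exprn_gt0 //.
  have CB0 : 0 <= C * B by rewrite mulr_ge0 // ltW.
  move: rC; rewrite mulrC ler_pdivrMr ?sqrtr_gt0 // => rC.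
  rewrite -(sqr_sqrtr CB0) -(sqr_sqrtr (ltW eta0)) -exprMn.
  apply: lerXn2r; rewrite ?nnegrE; first exact: sqrtr_ge0.
    by rewrite mulr_ge0 // sqrtr_ge0.
  by rewrite [leRHS]mulrC.
have -> : f + eta%:MP = f - (- eta)%:MP by rewrite mpolyCN opprK.
apply: preordering_of_lower_bound.
have := rate f r degf r1 rd; rewrite -/B; have := box_min_ge0 f0.
case: lower_bound => [l| |] // fmin0; last by rewrite leey.
by rewrite -EFinB !lee_fin; lra.
Qed.

(** The threshold is at most [(a + b) / sqrt eta] because [sqrt eta <= 1];
    rounding it up and passing from [r] to [r + 1] adds at most [2]. *)
Lemma preordering_rate (R : realType) n d (f : {mpoly R[n]}) :
  (1 <= n)%N -> tdeg f = d -> (forall x, box R n x -> 0 <= meval x f) ->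
  exists A : R, 0 < A /\ forall eta : R, 0 < eta -> eta <= 1 ->
    exists r : nat, r%:R <= A / Num.sqrt eta
      /\ preordering R n r (f + eta%:MP).
Proof.
move=> n1 degf f0; have [C [C0 rate]] := exists_rate_constant R d n1.
set a := @pi R * d%:R * Num.sqrt (2 * n%:R).
set b := Num.sqrt (C * (box_max f - box_min f)).
have a0 : 0 <= a by rewrite !mulr_ge0 ?pi_ge0 ?sqrtr_ge0.
have b0 : 0 <= b by apply: sqrtr_ge0.
have n0 : 0 < n%:R :> R by rewrite ltr0n.
exists ((a + b + 2) * n%:R); split; first by rewrite mulr_gt0 //; lra.
move=> eta eta0 eta1; set s := Num.sqrt eta.
have s0 : 0 < s by rewrite sqrtr_gt0.
have s1 : s <= 1 by rewrite -(sqrtr1 R) ler_wsqrtr.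
have is1 : 1 <= s^-1 by rewrite invf_ge1.
set x := Num.max a (s^-1 * b).
have x0 : 0 <= x by rewrite le_max a0.
have x_le : x <= (a + b) * s^-1 by rewrite ge_max; apply/andP; split; nra.
have /andP[tx xt] := truncn_itv x0.
exists ((Num.truncn x).+2 * n)%N; split; last first.
  by apply: (preordering_of_rate n1 C0 rate degf f0 eta0); apply: ltW.
rewrite natrM mulrAC ler_pM2r // -addn2 natrD mulrDl.
by apply: lerD; [apply: le_trans x_le|nra].
Qed.

Theorem corollary3 (R : realType) (n d : nat) (hn : (1 <= n)%N) :
  (exists C : R, 0 < C /\ rate_constant n d C)
  /\
  (forall C : R, 0 < C -> rate_constant n d C ->
   forall f : {mpoly R[n]}, tdeg f = d ->
   (forall x, box R n x -> 0 <= meval x f) ->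
   forall eta : R, 0 < eta ->
   forall r : nat,
     Num.max (@pi R * d%:R * Num.sqrt (2 * n%:R))
             ((Num.sqrt eta)^-1 * Num.sqrt (C * (box_max f - box_min f)))
       <= r%:R ->
     preordering R n (r.+1 * n) (f + eta%:MP))
  /\
  (forall f : {mpoly R[n]}, tdeg f = d ->
   (forall x, box R n x -> 0 <= meval x f) ->
   exists A : R, 0 < A /\
     forall eta : R, 0 < eta -> eta <= 1 ->
     exists r : nat, r%:R <= A / Num.sqrt eta
       /\ preordering R n r (f + eta%:MP)).
Proof.
split; first exact: exists_rate_constant.
split=> [C C0 rate f degf f0 eta eta0 r|f degf f0].
  exact: preordering_of_rate.
exact: preordering_rate.
Qed.
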